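(* Let $S=\sum_{n\ge0}P_nS_n$ be an $\mathbb H^{r\times s}$-valued Schur multiplier. Then for every $u\in\mathbb H^s$ the function $R_0(Su)=\sum_{n\ge0}P_nS_{n+1}u$ belongs to $\mathcal H(S)$ and $$\|R_0(Su)\|_{\mathcal H(S)}^2\le u^*u-(S(0)u)^*(S(0)u).$$
   Context: For $m\ge0$, $T^m_j=\frac{2(m-j+1)}{(m+1)(m+2)}$, $c_m=\sum_{j=0}^m(-1)^jT^m_j$, $P_m(x)=\frac1{c_m}\sum_{j=0}^mT^m_jx^{m-j}\overline{x}^{\,j}$. $\mathcal E=\{x\in\mathbb H:9x_0^2+x_1^2+x_2^2+x_3^2<1\}$. $\odot$ is the Cauchy–Kovalevskaya product, with $P_n\odot S=\sum_mP_{n+m}S_m$. An $\mathbb H^{r\times s}$-valued hyperholomorphic $S$ on $\mathcal E$ is a Schur multiplier if $K_S(x,y)=\sum_{n\ge0}\big(P_n(x)\overline{P_n(y)}I_r-(P_n\odot S)(x)((P_n\odot S)(y))^*\big)$ is positive definite on $\mathcal E$. $\mathcal H(S)$ is the reproducing kernel Hilbert space of $\mathbb H^r$-valued functions with reproducing kernel $K_S$. $R_0\big(\sum_nP_nf_n\big)=\sum_nP_nf_{n+1}$. *)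

(* Defs.v *)
From HB Require Import structures.
From mathcomp Require Import all_boot all_order all_algebra.
From mathcomp Require Import all_classical all_reals.
From mathcomp Require Import topology normedtype sequences.

Set Implicit Arguments.
Unset Strict Implicit.
Unset Printing Implicit Defensive.

Import Order.TTheory GRing.Theory Num.Theory.
Import numFieldNormedType.Exports.
Local Open Scope ring_scope.

Section Quaternions.
Variable R : realType.

Record quat := Quat { q0 : R; q1 : R; q2 : R; q3 : R }.

Definition qzero : quat := Quat 0 0 0 0.
Definition qone : quat := Quat 1 0 0 0.
Definition qreal (a : R) : quat := Quat a 0 0 0.
Definition qadd (x y : quat) : quat :=
  Quat (q0 x + q0 y) (q1 x + q1 y) (q2 x + q2 y) (q3 x + q3 y).
Definition qopp (x : quat) : quat := Quat (- q0 x) (- q1 x) (- q2 x) (- q3 x).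
Definition qsub (x y : quat) : quat := qadd x (qopp y).
Definition qmul (x y : quat) : quat :=
  Quat (q0 x * q0 y - q1 x * q1 y - q2 x * q2 y - q3 x * q3 y)
       (q0 x * q1 y + q1 x * q0 y + q2 x * q3 y - q3 x * q2 y)
       (q0 x * q2 y - q1 x * q3 y + q2 x * q0 y + q3 x * q1 y)
       (q0 x * q3 y + q1 x * q2 y - q2 x * q1 y + q3 x * q0 y).
Definition qconj (x : quat) : quat := Quat (q0 x) (- q1 x) (- q2 x) (- q3 x).
Definition qpow (x : quat) (n : nat) : quat := iter n (qmul x) qone.

Definition qis_real (x : quat) : Prop := q1 x = 0 /\ q2 x = 0 /\ q3 x = 0.

Definition hmat (r s : nat) := 'M[quat]_(r, s).
Definition hvec (r : nat) := hmat r 1.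

Definition hadd r s (A B : hmat r s) : hmat r s := \matrix_(i, j) qadd (A i j) (B i j).
Definition hsub r s (A B : hmat r s) : hmat r s := \matrix_(i, j) qsub (A i j) (B i j).
Definition hzero r s : hmat r s := \matrix_(i, j) qzero.
Definition hmul r s t (A : hmat r s) (B : hmat s t) : hmat r t :=
  \matrix_(i, j) \big[qadd/qzero]_(k < s) qmul (A i k) (B k j).
Definition hadj r s (A : hmat r s) : hmat s r := \matrix_(i, j) qconj (A j i).
Definition hscal r s (q : quat) (A : hmat r s) : hmat r s :=
  \matrix_(i, j) qmul q (A i j).
Definition hscar r s (A : hmat r s) (q : quat) : hmat r s :=
  \matrix_(i, j) qmul (A i j) q.
Definition hone r : hmat r r := \matrix_(i, j) if i == j then qone else qzero.

Definition qser_cvg (a : nat -> quat) : Prop :=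
  [/\ cvgn (series (fun n => q0 (a n))), cvgn (series (fun n => q1 (a n))),
      cvgn (series (fun n => q2 (a n))) & cvgn (series (fun n => q3 (a n)))].
Definition qser (a : nat -> quat) : quat :=
  Quat (limn (series (fun n => q0 (a n)))) (limn (series (fun n => q1 (a n))))
       (limn (series (fun n => q2 (a n)))) (limn (series (fun n => q3 (a n)))).

Definition hser_cvg r s (A : nat -> hmat r s) : Prop :=
  forall i j, qser_cvg (fun n => A n i j).
Definition hser r s (A : nat -> hmat r s) : hmat r s :=
  \matrix_(i, j) qser (fun n => A n i j).

Definition Tcoef (m j : nat) : R :=
  (2 * (m - j + 1))%N%:R / ((m + 1) * (m + 2))%N%:R.
Definition ccoef (m : nat) : R := \sum_(j < m.+1) (-1) ^+ j * Tcoef m j.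
Definition Ppoly (m : nat) (x : quat) : quat :=
  qmul (qreal (ccoef m)^-1)
    (\big[qadd/qzero]_(j < m.+1)
        qmul (qreal (Tcoef m j)) (qmul (qpow x (m - j)) (qpow (qconj x) j))).

Definition inEll (x : quat) : bool :=
  9 * q0 x ^+ 2 + q1 x ^+ 2 + q2 x ^+ 2 + q3 x ^+ 2 < 1.
Definition Ell := {x : quat | inEll x}.

Definition hfun r s (f : nat -> hmat r s) (x : quat) : hmat r s :=
  hser (fun n => hscal (Ppoly n x) (f n)).
Definition hfun_cvg r s (f : nat -> hmat r s) : Prop :=
  forall x : Ell, hser_cvg (fun n => hscal (Ppoly n (val x)) (f n)).
(* backward shift R_0 on coefficient sequences:
   R_0 (\sum_n P_n f_n) = \sum_n P_n f_{n+1} *)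
Definition R0coef r s (f : nat -> hmat r s) : nat -> hmat r s := fun n => f n.+1.
(* Cauchy--Kovalevskaya product P_n (.) S = \sum_m P_{n+m} S_m *)
Definition CKP r s (n : nat) (S : nat -> hmat r s) (x : quat) : hmat r s :=
  hser (fun m => hscal (Ppoly (n + m) x) (S m)).
Definition CKP_cvg r s (n : nat) (S : nat -> hmat r s) (x : quat) : Prop :=
  hser_cvg (fun m => hscal (Ppoly (n + m) x) (S m)).

Definition KSterm r s (S : nat -> hmat r s) (x y : quat) (n : nat) : hmat r r :=
  hsub (hscal (qmul (Ppoly n x) (qconj (Ppoly n y))) (hone r))
       (hmul (CKP n S x) (hadj (CKP n S y))).
Definition KS r s (S : nat -> hmat r s) (x y : quat) : hmat r r :=
  hser (KSterm S x y).

Definition kernel_pos r (K : quat -> quat -> hmat r r) : Prop :=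
  forall (N : nat) (ys : 'I_N -> Ell) (cs : 'I_N -> hvec r),
    let q := \big[qadd/qzero]_(i < N) \big[qadd/qzero]_(j < N)
               (hmul (hadj (cs i)) (hmul (K (val (ys i)) (val (ys j))) (cs j)))
                 ord0 ord0 in
    qis_real q /\ 0 <= q0 q.

Definition SchurMult r s (S : nat -> hmat r s) : Prop :=
  [/\ forall (n : nat) (x : Ell), CKP_cvg n S (val x),
      forall x y : Ell, hser_cvg (KSterm S (val x) (val y))
    & kernel_pos (KS S)].

Definition hfadd r (f g : Ell -> hvec r) : Ell -> hvec r := fun x => hadd (f x) (g x).
Definition hfsub r (f g : Ell -> hvec r) : Ell -> hvec r := fun x => hsub (f x) (g x).
Definition hfscar r (f : Ell -> hvec r) (a : quat) : Ell -> hvec r :=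
  fun x => hscar (f x) a.

Record qRKHS (r : nat) (K : quat -> quat -> hmat r r) := QRKHS {
  hspace : (Ell -> hvec r) -> Prop;
  hip : (Ell -> hvec r) -> (Ell -> hvec r) -> quat;
  space_add : forall f g, hspace f -> hspace g -> hspace (hfadd f g);
  space_scar : forall f a, hspace f -> hspace (hfscar f a);
  ip_add : forall f g h, hspace f -> hspace g -> hspace h ->
    hip (hfadd f g) h = qadd (hip f h) (hip g h);
  ip_scar : forall f g a, hspace f -> hspace g ->
    hip (hfscar f a) g = qmul (hip f g) a;
  ip_herm : forall f g, hspace f -> hspace g -> hip g f = qconj (hip f g);
  ip_pos : forall f, hspace f -> 0 <= q0 (hip f f);
  ip_def : forall f, hspace f -> hip f f = qzero -> forall x, f x = hzero r 1;
  complete : forall g : nat -> Ell -> hvec r, (forall n, hspace (g n)) ->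
    (forall e : R, 0 < e -> exists N, forall m n, (N <= m)%N -> (N <= n)%N ->
        q0 (hip (hfsub (g m) (g n)) (hfsub (g m) (g n))) < e) ->
    exists2 f, hspace f &
      forall e : R, 0 < e -> exists N, forall n, (N <= n)%N ->
        q0 (hip (hfsub (g n) f) (hfsub (g n) f)) < e;
  kernel_mem : forall (y : Ell) (c : hvec r),
    hspace (fun x : Ell => hmul (K (val x) (val y)) c);
  reproducing : forall f (y : Ell) (c : hvec r), hspace f ->
    hip f (fun x : Ell => hmul (K (val x) (val y)) c) = (hmul (hadj c) (f y)) ord0 ord0
}.

Definition hnorm2 r (K : quat -> quat -> hmat r r) (H : qRKHS K)
  (f : Ell -> hvec r) : R := q0 (hip H f f).

End Quaternions.

(* Main.v *)
From HB Require Import structures.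
Require Import Defs.
From mathcomp Require Import all_boot all_order all_algebra.
From mathcomp Require Import all_classical all_reals.
From mathcomp Require Import topology normedtype sequences.
From mathcomp Require Import ring lra zify.
Set Implicit Arguments.
Unset Strict Implicit.
Unset Printing Implicit Defensive.
Import Order.TTheory GRing.Theory Num.Theory.
Import numFieldNormedType.Exports.
Local Open Scope ring_scope.

(** Expand in the polynomials P_n: a finite combination h = sum_i K_S(., y_i) c_i has the
    coefficient sequence a_n = sum_i conj(P_n(y_i)) c_i, and
    |h|^2 = sum_n (|a_n|^2 - |(T a)_n|^2) with the co-analytic Toeplitz operator
    (T a)_n = sum_m S_m^* a_(n+m).  Since P_n(t i) = t^n i^n, the sequences a are dense among
    exponentially decaying ones, so T is a contraction there.  Applying this to (v, a_0, a_1, ...)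
    gives |S_0^* v + L a|^2 <= |v|^2 + |h|^2 with L a = sum_n S_(n+1)^* a_n, while
    sum_i <f(y_i), c_i> = <L a, u> for f = R_0(S u).  Taking v = t S_0 u and eliminating t
    yields |sum_i <f(y_i), c_i>|^2 <= (|u|^2 - |S_0 u|^2) |h|^2, and the Riesz
    representation theorem puts f in H(S) with the required norm. *)

(** * Quaternions and quaternionic matrices *)

Section QuatRing.
Variable R : realType.
Implicit Types x y z : quat R.

(** All estimates use the real form Re tr(A^* B). Quaternions and matrices cross it as adjoints,
    real parameters suffice for minimization and discriminants, and testing against every vector
    still recovers a quaternionic value. Prepending works because T (v, a) = (S_0^* v + L a, T a):
    the tail of the image is T a again, so the energies of a and T a combine into |h|^2 and only the
    first entry remains to be bounded. The obstacle is that (v, a) need not come from a kernel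
    combination, so positivity of the norm says nothing about it directly. Density has to be
    measured in a norm for which T is continuous before it is known to be a contraction. The sup
    norm weighted by rho^(-n) serves: convergence at imaginary points close to the boundary makes
    S_m grow slower than any exponential, and T is then bounded for this norm with a constant
    independent of a. *)

Definition quat_tuple x := (q0 x, q1 x, q2 x, q3 x).
Definition tuple_quat (t : R * R * R * R) := Quat t.1.1.1 t.1.1.2 t.1.2 t.2.
Lemma quat_tupleK : cancel quat_tuple tuple_quat.
Proof. by case. Qed.

Lemma quatP x y :
  [/\ q0 x = q0 y, q1 x = q1 y, q2 x = q2 y & q3 x = q3 y] -> x = y.
Proof. by case: x y => [????] [????] /= [-> -> -> ->]. Qed.

HB.instance Definition _ := Choice.copy (quat R) (can_type quat_tupleK).

Fact qaddA : associative (@qadd R).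
Proof. by move=> x y z; apply: quatP; split=> /=; ring. Qed.
Fact qaddC : commutative (@qadd R).
Proof. by move=> x y; apply: quatP; split=> /=; ring. Qed.
Fact qadd0 : left_id (qzero R) (@qadd R).
Proof. by move=> x; apply: quatP; split=> /=; ring. Qed.
Fact qaddN : left_inverse (qzero R) (@qopp R) (@qadd R).
Proof. by move=> x; apply: quatP; split=> /=; ring. Qed.
HB.instance Definition _ := GRing.isZmodule.Build (quat R) qaddA qaddC qadd0 qaddN.

Fact qmulA : associative (@qmul R).
Proof. by move=> x y z; apply: quatP; split=> /=; ring. Qed.
Fact qmul1 : left_id (qone R) (@qmul R).
Proof. by move=> x; apply: quatP; split=> /=; ring. Qed.
Fact qmulr1 : right_id (qone R) (@qmul R).
Proof. by move=> x; apply: quatP; split=> /=; ring. Qed.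
Fact qmulDl : left_distributive (@qmul R) (@qadd R).
Proof. by move=> x y z; apply: quatP; split=> /=; ring. Qed.
Fact qmulDr : right_distributive (@qmul R) (@qadd R).
Proof. by move=> x y z; apply: quatP; split=> /=; ring. Qed.
Fact qone_neq0 : qone R != 0.
Proof. by apply/eqP => -[/eqP]; rewrite oner_eq0. Qed.
HB.instance Definition _ := GRing.Zmodule_isNzRing.Build (quat R)
  qmulA qmul1 qmulr1 qmulDl qmulDr qone_neq0.

Lemma qpowE x n : qpow x n = x ^+ n.
Proof. by elim: n => // n IH; rewrite exprS -IH. Qed.

Lemma qrealM (s t : R) : qreal (s * t) = qreal s * qreal t.
Proof. by apply: quatP; split=> /=; ring. Qed.

Lemma qreal_comm (t : R) x : x * qreal t = qreal t * x.
Proof. by apply: quatP; split=> /=; ring. Qed.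

Lemma qrealX (t : R) n : qreal (t ^+ n) = qreal t ^+ n.
Proof. by elim: n => // n IH; rewrite !exprS qrealM IH. Qed.

Definition qdot x y : R :=
  q0 x * q0 y + q1 x * q1 y + q2 x * q2 y + q3 x * q3 y.

Lemma qdotC x y : qdot x y = qdot y x.
Proof. by rewrite /qdot; ring. Qed.
Lemma qdotDl x y z : qdot (x + y) z = qdot x z + qdot y z.
Proof. by rewrite /qdot /=; ring. Qed.
Lemma qdot0l z : qdot 0 z = 0.
Proof. by rewrite /qdot /=; ring. Qed.
Lemma qdotMl x y z : qdot (x * y) z = qdot y (qconj x * z).
Proof. by rewrite /qdot /=; ring. Qed.
Lemma qdotMr x y z : qdot (x * y) z = qdot x (z * qconj y).
Proof. by rewrite /qdot /=; ring. Qed.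
Lemma qdot_suml I (l : seq I) (F : I -> quat R) z :
  qdot (\sum_(i <- l) F i) z = \sum_(i <- l) qdot (F i) z.
Proof. by apply: (big_morph (fun x => qdot x z)) => [x y|]; rewrite ?qdotDl ?qdot0l. Qed.
Lemma qconj_mulV x : qconj x * x = qreal (qdot x x).
Proof. by apply: quatP; split=> /=; rewrite /qdot; ring. Qed.
Lemma qconj_realM t x : qconj (qreal t * x) = qreal t * qconj x.
Proof. by apply: quatP; split=> /=; ring. Qed.
Lemma q0_conjM x y : q0 (qconj x * y) = qdot y x.
Proof. by rewrite /qdot /=; ring. Qed.
Lemma qdotM x y : qdot (x * y) (x * y) = qdot x x * qdot y y.
Proof. by rewrite /qdot /=; ring. Qed.
Lemma qdot_ge0 x : 0 <= qdot x x.
Proof. by rewrite /qdot -!expr2 !addr_ge0 ?sqr_ge0. Qed.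

Definition qnorm x : R := Num.sqrt (qdot x x).

Lemma qnorm_ge0 x : 0 <= qnorm x. Proof. exact: sqrtr_ge0. Qed.
Lemma sqr_qnorm x : qnorm x ^+ 2 = qdot x x.
Proof. by rewrite sqr_sqrtr ?qdot_ge0. Qed.
Lemma qnormM x y : qnorm (x * y) = qnorm x * qnorm y.
Proof. by rewrite /qnorm qdotM sqrtrM ?qdot_ge0. Qed.
Lemma qnorm_conj x : qnorm (qconj x) = qnorm x.
Proof. by rewrite /qnorm /qdot /= !mulrNN. Qed.
Lemma qnorm_real (t : R) : qnorm (qreal t) = `|t|.
Proof. by rewrite /qnorm /qdot /= !mulr0 !addr0 -expr2 sqrtr_sqr. Qed.
Lemma qnorm0 : qnorm 0 = 0.
Proof. by rewrite -[0]/(qreal 0) qnorm_real normr0. Qed.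
Lemma qnorm1 : qnorm 1 = 1.
Proof. by rewrite -[1]/(qreal 1) qnorm_real normr1. Qed.
Lemma qnormX x n : qnorm (x ^+ n) = qnorm x ^+ n.
Proof. by elim: n => [|n IH]; rewrite ?qnorm1 // !exprS qnormM IH. Qed.

Lemma qdot_le x y : `|qdot x y| <= qnorm x * qnorm y.
Proof.
rewrite -ler_sqr ?nnegrE ?normr_ge0 ?mulr_ge0 ?qnorm_ge0 //.
(* Lagrange's identity for the quaternion product *)
rewrite real_normK ?num_real // exprMn !sqr_qnorm -subr_ge0.
have -> : qdot x x * qdot y y - qdot x y ^+ 2 =
  q1 (qconj x * y) ^+ 2 + q2 (qconj x * y) ^+ 2 + q3 (qconj x * y) ^+ 2.
  by rewrite /qdot /=; ring.
by rewrite !addr_ge0 ?sqr_ge0.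
Qed.

Lemma qnormD x y : qnorm (x + y) <= qnorm x + qnorm y.
Proof.
rewrite -ler_sqr ?nnegrE ?addr_ge0 ?qnorm_ge0 // sqrrD !sqr_qnorm.
rewrite qdotDl ![qdot _ (x + y)]qdotC !qdotDl [qdot y x]qdotC.
by have := qdot_le x y; move: (ler_norm (qdot x y)); lra.
Qed.

Lemma qnorm_sum I (s : seq I) P (F : I -> quat R) :
  qnorm (\sum_(i <- s | P i) F i) <= \sum_(i <- s | P i) qnorm (F i).
Proof.
elim/big_rec2: _ => [|i y x _ le_xy]; first by rewrite qnorm0.
by apply: le_trans (qnormD _ _) _; rewrite lerD2l.
Qed.

Lemma components_le_qnorm x :
  [/\ `|q0 x| <= qnorm x, `|q1 x| <= qnorm x, `|q2 x| <= qnorm x & `|q3 x| <= qnorm x].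
Proof.
have E a : a ^+ 2 <= qdot x x -> `|a| <= qnorm x.
  by move=> h; rewrite -sqrtr_sqr ler_sqrt ?qdot_ge0.
have := (sqr_ge0 (q0 x), sqr_ge0 (q1 x), sqr_ge0 (q2 x), sqr_ge0 (q3 x)).
by move=> [[[h0 h1] h2] h3]; split; apply: E; rewrite /qdot -!expr2; lra.
Qed.

End QuatRing.

(** * Real inner product and Frobenius norm of quaternionic matrices *)

Section QuatMatrix.
Variable R : realType.

Lemma haddE r s (A B : hmat R r s) : hadd A B = A + B.
Proof. by apply/matrixP => i j; rewrite !mxE. Qed.
Lemma hsubE r s (A B : hmat R r s) : hsub A B = A - B.
Proof. by apply/matrixP => i j; rewrite !mxE. Qed.
Lemma hmulE r s t (A : hmat R r s) (B : hmat R s t) : hmul A B = A *m B.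
Proof. by apply/matrixP => i j; rewrite !mxE. Qed.
Lemma hscalE r s q (A : hmat R r s) : hscal q A = q *: A.
Proof. by apply/matrixP => i j; rewrite !mxE. Qed.
Lemma honeE r : hone R r = 1%:M.
Proof. by apply/matrixP => i j; rewrite !mxE; case: eqP. Qed.
Lemma hscar_real r s (A : hmat R r s) (t : R) : hscar A (qreal t) = qreal t *: A.
Proof. by apply/matrixP => i j; rewrite !mxE; exact: qreal_comm. Qed.
Lemma mulmx_realr r s t (A : hmat R r s) (B : hmat R s t) (a : R) :
  A *m (qreal a *: B) = qreal a *: (A *m B).
Proof.
apply/matrixP => i j; rewrite !mxE mulr_sumr; apply: eq_bigr => k _.
by rewrite mxE mulrA qreal_comm mulrA.
Qed.
Lemma hadjK r s (A : hmat R r s) : hadj (hadj A) = A.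
Proof.
by apply/matrixP => i j; rewrite !mxE; apply: quatP; split=> //=; rewrite opprK.
Qed.

(** This is Re tr(A^* B). Left scaling and multiplication by a matrix on either side all have
    adjoints for it, which is what the later rearrangements of sums rest on. *)
Definition dot r s (A B : hmat R r s) : R := \sum_i \sum_j qdot (A i j) (B i j).

Lemma dotC r s (A B : hmat R r s) : dot A B = dot B A.
Proof. by apply: eq_bigr => i _; apply: eq_bigr => j _; rewrite qdotC. Qed.
Lemma dotDl r s (A B C : hmat R r s) : dot (A + B) C = dot A C + dot B C.
Proof.
rewrite /dot -big_split; apply: eq_bigr => i _; rewrite -big_split.
by apply: eq_bigr => j _; rewrite mxE qdotDl.
Qed.
Lemma dot0l r s (C : hmat R r s) : dot 0 C = 0.
Proof. by apply: big1 => i _; apply: big1 => j _; rewrite mxE qdot0l. Qed.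
Lemma dotNl r s (A C : hmat R r s) : dot (- A) C = - dot A C.
Proof. by apply/eqP; rewrite -addr_eq0 -dotDl addNr dot0l. Qed.
Lemma dotBl r s (A B C : hmat R r s) : dot (A - B) C = dot A C - dot B C.
Proof. by rewrite dotDl dotNl. Qed.
Lemma dotDr r s (A B C : hmat R r s) : dot C (A + B) = dot C A + dot C B.
Proof. by rewrite !(dotC C) dotDl. Qed.
Lemma dotBr r s (A B C : hmat R r s) : dot C (A - B) = dot C A - dot C B.
Proof. by rewrite !(dotC C) dotBl. Qed.
Lemma dot_suml r s I (l : seq I) P (F : I -> hmat R r s) C :
  dot (\sum_(i <- l | P i) F i) C = \sum_(i <- l | P i) dot (F i) C.
Proof. by apply: (big_morph (fun A => dot A C)) => [A B|]; rewrite ?dotDl ?dot0l. Qed.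
Lemma dotZl r s q (A C : hmat R r s) : dot (q *: A) C = dot A (qconj q *: C).
Proof. by apply: eq_bigr => i _; apply: eq_bigr => j _; rewrite !mxE qdotMl. Qed.
Lemma dotRl r s (t : R) (A C : hmat R r s) : dot (qreal t *: A) C = t * dot A C.
Proof.
rewrite /dot mulr_sumr; apply: eq_bigr => i _; rewrite mulr_sumr.
by apply: eq_bigr => j _; rewrite !mxE /qdot /=; ring.
Qed.
Lemma dotRr r s (t : R) (A C : hmat R r s) : dot C (qreal t *: A) = t * dot C A.
Proof. by rewrite !(dotC C) dotRl. Qed.

Lemma dotMl r s t (A : hmat R r s) (B : hmat R s t) C :
  dot (A *m B) C = dot B (hadj A *m C).
Proof.
rewrite /dot; under eq_bigr => i _ do under eq_bigr => j _ do rewrite mxE qdot_suml.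
 under [RHS]eq_bigr => i _ do under eq_bigr => j _ do
  rewrite mxE qdotC qdot_suml.
rewrite exchange_big /= [RHS]exchange_big /=; apply: eq_bigr => j _.
rewrite exchange_big /=; apply: eq_bigr => k _; apply: eq_bigr => i _.
by rewrite qdotMl qdotC !mxE.
Qed.
Lemma dotMr r s t (A : hmat R r s) (B : hmat R s t) C :
  dot (A *m B) C = dot A (C *m hadj B).
Proof.
rewrite /dot; apply: eq_bigr => i _; under eq_bigr => j _ do rewrite mxE qdot_suml.
under [RHS]eq_bigr => j _ do rewrite mxE qdotC qdot_suml.
rewrite exchange_big /=; apply: eq_bigr => k _; apply: eq_bigr => j _.
by rewrite qdotMr [RHS]qdotC mxE.
Qed.
Lemma dot_adjMl r s t (A : hmat R s r) (B : hmat R s t) C :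
  dot (hadj A *m B) C = dot B (A *m C).
Proof. by rewrite dotMl hadjK. Qed.

Lemma q0_adjM r (A B : hvec R r) : q0 ((hadj A *m B) ord0 ord0) = dot B A.
Proof.
rewrite mxE /dot (big_morph (@q0 R) (id1 := 0) (op1 := +%R)) //.
by apply: eq_bigr => i _; rewrite big_ord1 mxE q0_conjM.
Qed.

Lemma dot_ge0 r s (A : hmat R r s) : 0 <= dot A A.
Proof. by do 2!apply: sumr_ge0 => ? _; exact: qdot_ge0. Qed.

(** Common source of the Cauchy-Schwarz inequalities, of the near-minimality estimate in the Riesz
    argument and of the final elimination of t. For a > 0 the vertex -b/a is tested. *)
Lemma discriminant_le0 (a b c : R) : 0 <= a ->
  (forall t, 0 <= a * t ^+ 2 + 2 * b * t + c) -> b ^+ 2 <= a * c.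
Proof.
rewrite le_eqVlt => /predU1P[<-|a0] h.
  have [->|b0] := eqVneq b 0; first by rewrite expr0n /= mul0r.
  (* With a = 0 the affine function takes the value -1 here, so b must vanish. *)
  have := h (- (c + 1) / (2 * b)).
  have -> : 0 * (- (c + 1) / (2 * b)) ^+ 2 + 2 * b * (- (c + 1) / (2 * b)) + c = -1.
    by field.
  by rewrite oppr_ge0 ler10.
have := h (- b / a); rewrite -(pmulr_rge0 _ a0).
have -> : a * (a * (- b / a) ^+ 2 + 2 * b * (- b / a) + c) = a * c - b ^+ 2.
  by field; rewrite gt_eqF.
by rewrite subr_ge0.
Qed.

Lemma dot_CS r s (A B : hmat R r s) : dot A B ^+ 2 <= dot A A * dot B B.
Proof.
rewrite -sqrrN mulrC; apply: discriminant_le0; first exact: dot_ge0.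
move=> t; have := dot_ge0 (A - qreal t *: B).
by rewrite dotBl !dotBr dotRl !dotRr dotRl [dot B A]dotC; lra.
Qed.

Lemma dot_eq0 r s (A : hmat R r s) : dot A A = 0 -> A = 0.
Proof.
move=> A0; apply/matrixP => i j; rewrite mxE.
have := A0; move/eqP; rewrite psumr_eq0 => [|k _]; last first.
  by apply: sumr_ge0 => ? _; exact: qdot_ge0.
move=> /allP/(_ i); rewrite mem_index_enum => /(_ isT) /=.
rewrite psumr_eq0 => [|k _]; last exact: qdot_ge0.
move=> /allP/(_ j); rewrite mem_index_enum => /(_ isT) /= /eqP q0.
have := components_le_qnorm (A i j); rewrite /qnorm q0 sqrtr0 !normr_le0.
by move=> [/eqP ? /eqP ? /eqP ? /eqP ?]; apply: quatP.
Qed.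

Lemma dot_inj r s (A B : hmat R r s) : (forall C, dot A C = dot B C) -> A = B.
Proof.
by move=> h; apply/eqP; rewrite -subr_eq0; apply/eqP/dot_eq0; rewrite dotBl h subrr.
Qed.

Definition hnorm r s (A : hmat R r s) : R := Num.sqrt (dot A A).

Lemma hnorm_ge0 r s (A : hmat R r s) : 0 <= hnorm A.
Proof. exact: sqrtr_ge0. Qed.
Lemma sqr_hnorm r s (A : hmat R r s) : hnorm A ^+ 2 = dot A A.
Proof. by rewrite sqr_sqrtr ?dot_ge0. Qed.
Lemma dot_le r s (A B : hmat R r s) : `|dot A B| <= hnorm A * hnorm B.
Proof.
rewrite -ler_sqr ?nnegrE ?normr_ge0 ?mulr_ge0 ?hnorm_ge0 //.
by rewrite real_normK ?num_real // exprMn !sqr_hnorm dot_CS.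
Qed.
Lemma hnormD r s (A B : hmat R r s) : hnorm (A + B) <= hnorm A + hnorm B.
Proof.
rewrite -ler_sqr ?nnegrE ?addr_ge0 ?hnorm_ge0 // sqrrD !sqr_hnorm.
rewrite dotDl !dotDr [dot B A]dotC.
by have := dot_le A B; move: (ler_norm (dot A B)); lra.
Qed.
Lemma hnormZ r s q (A : hmat R r s) : hnorm (q *: A) = qnorm q * hnorm A.
Proof.
rewrite /hnorm /qnorm -sqrtrM ?qdot_ge0 //; congr Num.sqrt.
rewrite /dot mulr_sumr; apply: eq_bigr => i _; rewrite mulr_sumr.
by apply: eq_bigr => j _; rewrite mxE qdotM.
Qed.
Lemma hnormN r s (A : hmat R r s) : hnorm (- A) = hnorm A.
Proof. by rewrite /hnorm dotNl dotC dotNl opprK. Qed.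
Lemma hnorm0 r s : hnorm (0 : hmat R r s) = 0.
Proof. by rewrite /hnorm dot0l sqrtr0. Qed.
Lemma hnorm_adj r s (A : hmat R r s) : hnorm (hadj A) = hnorm A.
Proof.
rewrite /hnorm /dot exchange_big; congr Num.sqrt.
apply: eq_bigr => i _; apply: eq_bigr => j _.
by rewrite !mxE /qdot /= !mulrNN.
Qed.
Lemma qnorm_le_hnorm r s (A : hmat R r s) i j : qnorm (A i j) <= hnorm A.
Proof.
rewrite ler_sqrt ?dot_ge0 // /dot (bigD1 i) //= (bigD1 j) //= -addrA lerDl addr_ge0 //.
  by apply: sumr_ge0 => ? _; exact: qdot_ge0.
by do 2!apply: sumr_ge0 => ? _; exact: qdot_ge0.
Qed.
(** Cauchy-Schwarz on the entry norms of each row of [A] against each column of [B]. *)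
Lemma hnormM r s t (A : hmat R r s) (B : hmat R s t) :
  hnorm (A *m B) <= hnorm A * hnorm B.
Proof.
have CS (x y : 'I_s -> R) :
    (\sum_k x k * y k) ^+ 2 <= (\sum_k x k ^+ 2) * (\sum_k y k ^+ 2).
  apply: discriminant_le0 => [|e]; first by apply: sumr_ge0 => ? _; exact: sqr_ge0.
  rewrite mulr_suml mulr_sumr mulr_suml -!big_split /=.
  apply: sumr_ge0 => k _; have := sqr_ge0 (x k * e + y k); lra.
rewrite -ler_sqr ?nnegrE ?mulr_ge0 ?hnorm_ge0 // exprMn !sqr_hnorm.
rewrite [dot B B]exchange_big /= mulr_suml; apply: ler_sum => i _.
rewrite mulr_sumr; apply: ler_sum => j _.
rewrite -sqr_qnorm mxE.
have -> : \sum_k qdot (A i k) (A i k) = \sum_k qnorm (A i k) ^+ 2.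
  by apply: eq_bigr => k _; rewrite sqr_qnorm.
have -> : \sum_k qdot (B k j) (B k j) = \sum_k qnorm (B k j) ^+ 2.
  by apply: eq_bigr => k _; rewrite sqr_qnorm.
apply: le_trans (CS _ _); rewrite ler_sqr ?nnegrE ?qnorm_ge0 //.
  apply: le_trans (qnorm_sum _ _ _) _.
  by apply: ler_sum => k _; rewrite qnormM.
by apply: sumr_ge0 => k _; rewrite mulr_ge0 ?qnorm_ge0.
Qed.

End QuatMatrix.

(** * Series of quaternionic matrices *)

Section QuatSeries.
Variable R : realType.
Local Open Scope classical_set_scope.

Lemma cvg_series_geometric_le (u : nat -> R) (C rho : R) : 0 <= rho < 1 ->
  (forall k, `|u k| <= C * rho ^+ k) ->
  exists2 l : R, series u @ \oo --> l & `|l| <= C / (1 - rho).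
Proof.
move=> /andP[rho0 rho1] hu.
have rhoN : `|rho| < 1 by rewrite ger0_norm.
have cg := @is_cvg_geometric_series R C _ rhoN.
have C0 k : 0 <= C * rho ^+ k by apply: le_trans (hu k).
have cn : cvgn [normed series u] by apply: (series_le_cvg _ C0 hu cg) => n; exact: normr_ge0.
exists (limn (series u)); first exact: normed_cvg.
apply: le_trans (lim_series_norm cn) _.
rewrite -(cvg_lim _ (cvg_geometric_series rhoN)) //.
by apply: lim_series_le.
Qed.

Lemma eq_cvg_series (u v : nat -> R) (l : R) : u =1 v ->
  series u @ \oo --> l -> series v @ \oo --> l.
Proof. by move=> /funext ->. Qed.

Lemma cvg_sumr I (l : seq I) (F : I -> nat -> R) (L : I -> R) :
  (forall i, F i @ \oo --> L i) ->
  (fun n => \sum_(i <- l) F i n) @ \oo --> \sum_(i <- l) L i.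
Proof.
move=> h; elim: l => [|i l IH].
  by rewrite big_nil; under eq_fun do rewrite big_nil; exact: cvg_cst.
by rewrite big_cons; under eq_fun do rewrite big_cons; exact: cvgD.
Qed.

(* Convergence tested against [dot]: adjoints then move linear maps across the sum. *)
Definition wseries r s (A : nat -> hmat R r s) (L : hmat R r s) : Prop :=
  forall C, series (fun k => dot (A k) C) @ \oo --> dot L C.

Lemma hser_wseries r s (A : nat -> hmat R r s) : hser_cvg A -> wseries A (hser A).
Proof.
move=> cA C.
have -> : series (fun k => dot (A k) C) =
    fun n => \sum_i \sum_j
     (series (fun k => q0 (A k i j)) n * q0 (C i j) +
      series (fun k => q1 (A k i j)) n * q1 (C i j) +
      series (fun k => q2 (A k i j)) n * q2 (C i j) +
      series (fun k => q3 (A k i j)) n * q3 (C i j)).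
  apply/funext => n; rewrite /series /= exchange_big; apply: eq_bigr => i _.
  rewrite exchange_big; apply: eq_bigr => j _.
  by rewrite !mulr_suml -!big_split.
have [c0 c1 c2 c3] : [/\ forall i j, series (fun k => q0 (A k i j)) @ \oo --> q0 (hser A i j),
  forall i j, series (fun k => q1 (A k i j)) @ \oo --> q1 (hser A i j),
  forall i j, series (fun k => q2 (A k i j)) @ \oo --> q2 (hser A i j) &
  forall i j, series (fun k => q3 (A k i j)) @ \oo --> q3 (hser A i j)].
  by split=> i j; rewrite mxE; have [] := cA i j.
apply: cvg_sumr => i; apply: cvg_sumr => j.
by do 3!(apply: cvgD; last exact: cvgMr_tmp); exact: cvgMr_tmp.
Qed.

Lemma wseries_hser r s (A : nat -> hmat R r s) L :
  wseries A L -> hser_cvg A /\ hser A = L.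
Proof.
(* Testing against a single entry equal to 1, i, j or k isolates one real component of the sum. *)
pose E i j q : hmat R r s := \matrix_(a, b) if (a == i) && (b == j) then q else 0.
have dotE B i j q : dot B (E i j q) = qdot (B i j) q.
  rewrite /dot (bigD1 i) //= (bigD1 j) //= mxE !eqxx /=.
  rewrite !big1 ?addr0 // => [a ai|b bj].
    by apply: big1 => b _; rewrite mxE (negPf ai) qdotC qdot0l.
  by rewrite mxE eqxx (negPf bj) qdotC qdot0l.
move=> wA.
have comp i j : [/\ series (fun k => q0 (A k i j)) @ \oo --> q0 (L i j),
  series (fun k => q1 (A k i j)) @ \oo --> q1 (L i j),
  series (fun k => q2 (A k i j)) @ \oo --> q2 (L i j) &
  series (fun k => q3 (A k i j)) @ \oo --> q3 (L i j)].
  split.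
  - have := wA (E i j (Quat 1 0 0 0)); rewrite dotE /qdot /= !mulr0 !addr0 mulr1.
    apply: eq_cvg_series => k.
    by rewrite dotE /qdot /= !mulr0 !addr0 mulr1.
  - have := wA (E i j (Quat 0 1 0 0)); rewrite dotE /qdot /= !mulr0 !addr0 add0r mulr1.
    apply: eq_cvg_series => k.
    by rewrite dotE /qdot /= !mulr0 !addr0 add0r mulr1.
  - have := wA (E i j (Quat 0 0 1 0)); rewrite dotE /qdot /= !mulr0 !addr0 !add0r mulr1.
    apply: eq_cvg_series => k.
    by rewrite dotE /qdot /= !mulr0 !addr0 !add0r mulr1.
  - have := wA (E i j (Quat 0 0 0 1)); rewrite dotE /qdot /= !mulr0 !addr0 !add0r mulr1.
    apply: eq_cvg_series => k.
    by rewrite dotE /qdot /= !mulr0 !addr0 !add0r mulr1.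
split=> [i j|]; first by have [? ? ? ?] := comp i j; split; apply: cvgP; eassumption.
apply/matrixP => i j; rewrite mxE; have [? ? ? ?] := comp i j.
by apply: quatP; split=> /=; apply: cvg_lim.
Qed.

Lemma wseriesD r s (A B : nat -> hmat R r s) L M :
  wseries A L -> wseries B M -> wseries (fun k => A k + B k) (L + M).
Proof.
move=> wA wB C; rewrite dotDl.
have -> : series (fun k => dot (A k + B k) C) =
   series (fun k => dot (A k) C) \+ series (fun k => dot (B k) C).
  by apply/funext => n; rewrite /series /= -big_split; apply: eq_bigr => k _; rewrite dotDl.
exact: cvgD (wA C) (wB C).
Qed.

Lemma wseriesN r s (A : nat -> hmat R r s) L :
  wseries A L -> wseries (fun k => - A k) (- L).
Proof.
move=> wA C; rewrite dotNl.
have -> : series (fun k => dot (- A k) C) = \- series (fun k => dot (A k) C).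
  by apply/funext => n; rewrite /series /= -sumrN; apply: eq_bigr => k _; rewrite dotNl.
exact: cvgN (wA C).
Qed.

Lemma cvg_seriesS (u : nat -> R) (l : R) :
  series (fun k => u k.+1) @ \oo --> l -> series u @ \oo --> u 0 + l.
Proof.
move=> hu; rewrite -(cvg_shiftS (series _)).
have -> : [sequence series u n.+1]_n = (fun=> u 0) \+ series (fun k => u k.+1).
  by apply/funext => n; rewrite /= /series /= big_nat_recl.
by apply: cvgD => //; apply: cvg_cst.
Qed.

Lemma wseriesS r s (A : nat -> hmat R r s) L :
  wseries (fun k => A k.+1) L -> wseries A (A 0 + L).
Proof. by move=> wA C; rewrite dotDl; apply: cvg_seriesS; exact: wA. Qed.

Lemma wseries_behead r s (A : nat -> hmat R r s) L :
  wseries A L -> wseries (fun k => A k.+1) (L - A 0).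
Proof.
move=> wA C; have := wA C; rewrite -(cvg_shiftS (series _)) dotBl => h.
have -> : series (fun k => dot (A k.+1) C) =
    [sequence series (fun k => dot (A k) C) n.+1]_n \- (fun=> dot (A 0) C).
  by apply/funext => n; rewrite /= /series /= big_nat_recl // addrC addKr.
by apply: cvgB => //; apply: cvg_cst.
Qed.

Lemma wseries0 r s (A : nat -> hmat R r s) : (forall k, A k = 0) -> wseries A 0.
Proof.
move=> A0 C; rewrite dot0l.
have -> : series (fun k => dot (A k) C) = fun=> 0.
  by apply/funext => n; rewrite /series /= big1 // => k _; rewrite A0 dot0l.
exact: cvg_cst.
Qed.

Lemma wseries_geometric r s (A : nat -> hmat R r s) (C rho : R) :
  0 <= rho < 1 -> (forall k, hnorm (A k) <= C * rho ^+ k) ->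
  wseries A (hser A) /\ hnorm (hser A) <= C / (1 - rho).
Proof.
move=> rho01 hA.
have cA : hser_cvg A.
  move=> i j.
  suff h (F : quat R -> R) : (forall x, `|F x| <= qnorm x) ->
      cvgn (series (fun n => F (A n i j))).
    by split; apply: h => x; have [] := components_le_qnorm x.
  move=> hF; have [||l + _] := @cvg_series_geometric_le (fun n => F (A n i j)) C rho.
  - exact: rho01.
  - by move=> k; apply: le_trans (hF _) (le_trans (qnorm_le_hnorm _ _ _) (hA k)).
  - exact: cvgP.
split; first exact: hser_wseries.
set L := hser A.
have wA : wseries A L by exact: hser_wseries.
(* Pairing the series with its own sum L gives |L|^2 <= C |L| / (1 - rho), and |L| is divided out
   when nonzero. *)
have [|k|l hl ll] := @cvg_series_geometric_le (fun k => dot (A k) L) (C * hnorm L) rho.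
- exact: rho01.
- by apply: le_trans (dot_le _ _) _; rewrite mulrAC ler_wpM2r ?hnorm_ge0.
have E : l = dot L L by apply: (cvg_unique _ hl (wA L)).
have [->|L0] := eqVneq (hnorm L) 0.
  have /andP[_ rho1] := rho01.
  by rewrite divr_ge0 ?subr_ge0 ?(ltW rho1) // -[C]mulr1 -(expr0 rho) (le_trans _ (hA 0)) ?hnorm_ge0.
have Lgt : 0 < hnorm L by rewrite lt_def L0 hnorm_ge0.
rewrite -(ler_pM2r Lgt) -expr2 sqr_hnorm -E mulrAC.
by apply: le_trans ll; exact: ler_norm.
Qed.

Lemma wseries_bounded r s (A : nat -> hmat R r s) : hser_cvg A ->
  exists2 C : R, 0 <= C & forall k, hnorm (A k) <= C.
Proof.
move=> cA.
pose bnd (u : nat -> R) := exists M : R, forall k, `|u k| <= M.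
have bnd_sum I (l : seq I) (F : I -> nat -> R) :
    (forall i, bnd (F i)) -> bnd (fun k => \sum_(i <- l) F i k).
  move=> hF; elim: l => [|i l [M hM]].
    by exists 0 => k; rewrite big_nil normr0.
  have [N hN] := hF i; exists (N + M) => k; rewrite big_cons.
  by apply: le_trans (ler_normD _ _) _; rewrite lerD.
have bnd_sqr (u : nat -> R) : cvgn (series u) -> bnd (fun k => u k * u k).
  move=> cu; have /cvg_series_bounded/pinfty_ex_gt0[M M0 hM] := cu.
  exists (M * M) => k; rewrite normrM ler_pM //; exact: hM.
have bndD u v : bnd u -> bnd v -> bnd (fun k => u k + v k).
  move=> [M hM] [N hN]; exists (M + N) => k.
  by apply: le_trans (ler_normD _ _) _; rewrite lerD.
have [M hM] : bnd (fun k => dot (A k) (A k)).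
  apply: (bnd_sum) => i; apply: (bnd_sum) => j; have [? ? ? ?] := cA i j.
  by do 3!(apply: (bndD); last exact: bnd_sqr); exact: bnd_sqr.
exists (Num.sqrt M) => [|k]; first exact: sqrtr_ge0.
have M0 : 0 <= M by apply: le_trans (hM 0).
by rewrite ler_sqrt // (le_trans _ (hM k)) // ler_norm.
Qed.

End QuatSeries.

(** * The polynomials P_n *)

Section Ppoly.
Variable R : realType.

(** Equivalently, the weights [Tcoef m j] sum to 1 over j. *)
Lemma sum_Tnum m :
  \sum_(j < m.+1) (2 * (m - j + 1))%N%:R = ((m + 1) * (m + 2))%N%:R :> R.
Proof.
elim: m => [|m IH]; first by rewrite big_ord1.
rewrite big_ord_recl /=.
under eq_bigr => i _ do rewrite /bump /= add1n subSS.
by rewrite IH -natrD; congr _%:R; lia.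
Qed.

(** Splitting off j = 0 reverses the signs of the rest, so the sums A_m satisfy A_(m+1) = 2 (m + 2)
    - A_m. Hence c_m is 1/(m+1) for even m and 1/(m+2) for odd m. *)
Lemma sum_alt_Tnum m :
  \sum_(j < m.+1) (-1) ^+ j * (2 * (m - j + 1))%N%:R = (m + 1 + ~~ odd m)%N%:R :> R.
Proof.
elim: m => [|m IH]; first by rewrite big_ord1 expr0 mul1r.
rewrite big_ord_recl /= expr0 mul1r.
under eq_bigr => i _ do rewrite /bump /= add1n subSS exprS mulN1r mulNr.
rewrite sumrN IH; apply/eqP; rewrite subr_eq -natrD; apply/eqP; congr _%:R.
by case: (odd m) => /=; lia.
Qed.

Lemma ccoef_ge m : (m + 2)%N%:R^-1 <= ccoef R m.
Proof.
rewrite /ccoef /Tcoef; under eq_bigr => j _ do rewrite mulrA.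
rewrite -mulr_suml sum_alt_Tnum natrM invfM mulrA ler_peMl ?invr_ge0 //.
by rewrite ler_pdivlMr ?ltr0n ?addn1 // mul1r ler_nat leq_addr.
Qed.

Lemma ccoef_gt0 m : 0 < ccoef R m.
Proof. by apply: lt_le_trans (ccoef_ge m); rewrite invr_gt0 ltr0n addn2. Qed.

Lemma PpolyE m (x : quat R) : Ppoly m x =
  qreal (ccoef R m)^-1 *
    \sum_(j < m.+1) qreal (Tcoef R m j) * (x ^+ (m - j) * qconj x ^+ j).
Proof. by rewrite /Ppoly; under eq_bigr => j _ do rewrite !qpowE. Qed.

(** Before division by c_m the polynomial is a convex combination of terms of norm |x|^m, and 1/c_m
    is at most m + 2. *)
Lemma qnorm_Ppoly m (x : quat R) : qnorm (Ppoly m x) <= (m + 2)%:R * qnorm x ^+ m.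
Proof.
rewrite PpolyE qnormM qnorm_real ger0_norm ?invr_ge0 ?(ltW (ccoef_gt0 _)) //.
apply: ler_pM; rewrite ?invr_ge0 ?qnorm_ge0 ?(ltW (ccoef_gt0 _)) //.
  by rewrite -[leRHS]invrK lef_pV2 ?ccoef_ge ?posrE ?ccoef_gt0 // invr_gt0 ltr0n addn2.
have T0 (j : 'I_m.+1) : 0 <= Tcoef R m j by rewrite /Tcoef divr_ge0.
apply: le_trans (qnorm_sum _ _ _) _.
apply: (@le_trans _ _ (\sum_(j < m.+1) Tcoef R m j * qnorm x ^+ m)).
  apply: ler_sum => j _; rewrite !qnormM !qnormX qnorm_conj qnorm_real ger0_norm //.
  by rewrite -exprD subnK // -ltnS.
rewrite -mulr_suml /Tcoef -mulr_suml sum_Tnum divff ?mul1r //.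
by rewrite pnatr_eq0 muln_eq0 addn1 addn2.
Qed.

(** For imaginary x the powers of the conjugate contribute the signs (-1)^j, the sum collapses to
    c_m x^m, and the normalization cancels c_m. *)
Lemma Ppoly_imag m (x : quat R) : qconj x = - x -> Ppoly m x = x ^+ m.
Proof.
move=> xI; rewrite PpolyE xI.
have qreal_sum (F : 'I_m.+1 -> R) : \sum_j qreal (F j) = qreal (\sum_j F j).
  apply/esym/(big_morph _ (id1 := 0) (op1 := +%R)) => // a b.
  by apply: quatP; split=> //=; rewrite addr0.
have E (j : 'I_m.+1) : qreal (Tcoef R m j) * (x ^+ (m - j) * (- x) ^+ j) =
    qreal ((-1) ^+ j * Tcoef R m j) * x ^+ m.
  have -> : (- x) ^+ j = qreal ((-1) ^+ j) * x ^+ j.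
    rewrite [LHS]exprNn qrealX (_ : qreal (-1) = -1 :> quat R) //.
    by apply: quatP; split=> //=; rewrite oppr0.
  have -> : x ^+ m = x ^+ (m - j) * x ^+ j by rewrite -exprD subnK // -ltnS.
  move: (x ^+ _) (x ^+ _) ((-1) ^+ j : R) (Tcoef R m j) => P Q sg T.
  by rewrite [sg * T]mulrC qrealM -mulrA; congr (_ * _); rewrite !mulrA qreal_comm.
under eq_bigr => j _ do rewrite E.
rewrite -mulr_suml qreal_sum mulrA -qrealM mulVf ?gt_eqF ?ccoef_gt0 //.
by rewrite [qreal 1]/(1 : quat R) mul1r.
Qed.

Definition qimag (t : R) : quat R := Quat 0 t 0 0.

Lemma qimag_pow t m : qimag t ^+ m = qreal (t ^+ m) * qimag 1 ^+ m.
Proof.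
have -> : qimag t = qreal t * qimag 1 by apply: quatP; split=> /=; ring.
rewrite exprMn_comm ?qrealX //; apply/esym; exact: qreal_comm.
Qed.

Lemma Ppoly_qimag m t : Ppoly m (qimag t) = qreal (t ^+ m) * qimag 1 ^+ m.
Proof.
have h : qconj (qimag t) = - qimag t by apply: quatP; split=> /=; rewrite ?oppr0.
by rewrite (Ppoly_imag _ h) qimag_pow.
Qed.

Lemma qnorm_qimag1X m : qnorm (qimag 1 ^+ m) = 1.
Proof.
rewrite qnormX /qnorm /qdot /= !mulr0 mulr1 !addr0 add0r sqrtr1; exact: expr1n.
Qed.

Lemma inEll_qimag t : `|t| < 1 -> inEll (qimag t).
Proof.
move=> t1; rewrite /inEll /= expr0n /= mulr0 !addr0 add0r.
rewrite -real_normK ?num_real // expr_lt1 //.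
Qed.

Lemma qnorm_Ell (x : Ell R) : qnorm (val x) < 1.
Proof.
rewrite -[1]sqrtr1 /qnorm ltr_sqrt //; apply: le_lt_trans (valP x).
by rewrite /qdot; have := sqr_ge0 (q0 (val x)); lra.
Qed.

Lemma mul_geometric_le (a b : R) : 0 <= a -> a < b ->
  exists2 C : R, 0 <= C & forall n : nat, (n + 2)%:R * a ^+ n <= C * b ^+ n.
Proof.
move=> a0 ab; have d0 : 0 < b - a by rewrite subr_gt0.
have b0 : 0 <= b by exact: ltW (le_lt_trans a0 ab).
have C0 : 0 <= a / (b - a) by rewrite divr_ge0 // ltW.
(* The induction step needs a <= C (b - a) and the base case needs C >= 2; this C satisfies both. *)
exists (2 + a / (b - a)) => [|n]; first exact: addr_ge0.
elim: n => [|n IH]; first by rewrite !expr0 !mulr1 add0n lerDl.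
have -> : (n.+1 + 2)%:R * a ^+ n.+1 = a * ((n + 2)%:R * a ^+ n) + a * a ^+ n.
  by rewrite addSn -natr1 exprS; ring.
apply: (@le_trans _ _ (a * ((2 + a / (b - a)) * b ^+ n) + a * b ^+ n)).
  by apply: lerD; rewrite ler_wpM2l // lerXn2r ?nnegrE // ltW.
rewrite -subr_ge0 (_ : _ - _ = 2 * (b - a) * b ^+ n); last first.
  by rewrite exprS; field; rewrite gt_eqF.
by rewrite !mulr_ge0 ?exprn_ge0 // ltW.
Qed.

Lemma qnorm_Ppoly_geometric (x : Ell R) : exists rho C : R,
  [/\ 0 < rho, rho < 1, 0 <= C & forall n, qnorm (Ppoly n (val x)) <= C * rho ^+ n].
Proof.
have x1 := qnorm_Ell x; have x0 := qnorm_ge0 (val x).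
have [|C C0 hC] := @mul_geometric_le (qnorm (val x)) ((qnorm (val x) + 1) / 2) x0.
  by lra.
exists ((qnorm (val x) + 1) / 2), C; split=> // [||n]; [lra|lra|].
exact: le_trans (qnorm_Ppoly _ _) (hC n).
Qed.

End Ppoly.

(** * The Riesz representation theorem on a reproducing kernel space *)

Section KernelCombinations.
Variables (R : realType) (r : nat).
Variable K : quat R -> quat R -> hmat R r r.
Implicit Types (D E : seq (Ell R * hvec R r)) (f g h : Ell R -> hvec R r).

Definition kcomb D : Ell R -> hvec R r :=
  fun x => \sum_(p <- D) K (val x) (val p.1) *m p.2.

(** The value that [rip f (kcomb D)] must have if f lies in the space; it makes sense before
    membership is known. *)
Definition evals f D : R := \sum_(p <- D) dot (f p.1) p.2.

(** Formal combination D + t E. Working with lists avoids the question of whether [evals f] is well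
    defined on functions, since several lists may give the same [kcomb]. *)
Definition addscale D (t : R) E := D ++ [seq (p.1, qreal t *: p.2) | p <- E].

Lemma kcomb_addscale D t E :
  kcomb (addscale D t E) = hfadd (kcomb D) (hfscar (kcomb E) (qreal t)).
Proof.
apply/funext => x; rewrite /kcomb /hfadd /hfscar haddE hscar_real big_cat big_map /=.
by rewrite scaler_sumr; congr (_ + _); apply: eq_bigr => p _; rewrite mulmx_realr.
Qed.

Lemma evals_addscale f D t E : evals f (addscale D t E) = evals f D + t * evals f E.
Proof.
rewrite /evals big_cat big_map /= mulr_sumr; congr (_ + _).
by apply: eq_bigr => p _; rewrite dotRr.
Qed.

Variable H : qRKHS K.
Definition rip f g : R := q0 (hip H f g).

Lemma ripC f g : hspace H f -> hspace H g -> rip f g = rip g f.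
Proof. by move=> hf hg; rewrite /rip (ip_herm hf hg). Qed.

Lemma hspace_addscale f (t : R) g : hspace H f -> hspace H g ->
  hspace H (hfadd f (hfscar g (qreal t))).
Proof. by move=> hf hg; apply: space_add => //; apply: space_scar. Qed.

Lemma rip_addscalel f t g h : hspace H f -> hspace H g -> hspace H h ->
  rip (hfadd f (hfscar g (qreal t))) h = rip f h + t * rip g h.
Proof.
move=> hf hg hh; rewrite /rip ip_add //; last exact: space_scar.
by rewrite ip_scar //=; ring.
Qed.

Lemma rip_addscale2 f t g : hspace H f -> hspace H g ->
  rip (hfadd f (hfscar g (qreal t))) (hfadd f (hfscar g (qreal t))) =
  rip f f + 2 * t * rip f g + t ^+ 2 * rip g g.
Proof.
move=> hf hg; have hfg := hspace_addscale t hf hg.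
rewrite rip_addscalel // ![rip _ (hfadd _ _)]ripC // !rip_addscalel //.
by rewrite [rip g f]ripC //; ring.
Qed.

Lemma hfsubE f g : hfsub f g = hfadd f (hfscar g (qreal (- 1))).
Proof.
apply/funext => x; rewrite /hfsub /hfadd /hfscar hsubE haddE hscar_real.
congr (_ + _); rewrite -scaleN1r; congr (_ *: _).
by apply: quatP; split=> /=; rewrite ?oppr0.
Qed.

Lemma rip_ge0 f : hspace H f -> 0 <= rip f f.
Proof. exact: ip_pos. Qed.

Lemma rip_CS f g : hspace H f -> hspace H g -> rip f g ^+ 2 <= rip f f * rip g g.
Proof.
move=> hf hg; rewrite mulrC; apply: discriminant_le0; first exact: rip_ge0.
move=> t; have := rip_ge0 (hspace_addscale t hf hg).
by rewrite rip_addscale2 //; lra.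
Qed.

Lemma hspace_kcomb D : hspace H (kcomb D).
Proof.
elim: D => [|[y c] D IH].
  (* The zero function belongs to the space as the kernel section at the origin with coefficient
     0. *)
  have zE : inEll (qimag (0 : R)) by apply: inEll_qimag; rewrite normr0.
  have := kernel_mem H (exist (fun x : quat R => inEll x) _ zE) 0; congr hspace; apply/funext => x.
  by rewrite /kcomb big_nil hmulE mulmx0.
have := space_add (kernel_mem H y c) IH; congr hspace; apply/funext => x.
by rewrite /kcomb big_cons /hfadd haddE hmulE.
Qed.

Lemma rip_kcomb f D : hspace H f -> rip f (kcomb D) = evals f D.
Proof.
move=> hf; elim: D => [|[y c] D IH].
  have hn := hspace_kcomb [::].
  (* Writing zero as 0 + (-1) 0 lets linearity give the pairing p - p = 0. *)
  have -> : kcomb [::] = hfadd (kcomb [::]) (hfscar (kcomb [::]) (qreal (-1))).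
    apply/funext => x; rewrite /hfadd /hfscar haddE hscar_real /kcomb big_nil.
    by rewrite scaler0 addr0.
  by rewrite ripC ?rip_addscalel // ?mulN1r ?subrr /evals ?big_nil //; exact: hspace_addscale.
have hy := kernel_mem H y c.
have -> : kcomb ((y, c) :: D) =
    hfadd (fun x => hmul (K (val x) (val y)) c) (hfscar (kcomb D) (qreal 1)).
  apply/funext => x; rewrite /kcomb big_cons /hfadd /hfscar haddE hmulE hscar_real.
  by rewrite [qreal 1]/(1 : quat R) scale1r.
have hD := hspace_kcomb D.
rewrite ripC ?rip_addscalel //; last exact: hspace_addscale.
rewrite mul1r [rip (kcomb D) f]ripC // IH [rip _ f]ripC // /evals big_cons.
by congr (_ + _); rewrite /rip reproducing // hmulE q0_adjM.
Qed.

(* Riesz representation on the span of the kernels: a minimizing sequence of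
   D |-> |kcomb D|^2 - 2 * evals f D is Cauchy, and its limit is f. *)
Theorem rkhs_bounded_evals f (M : R) : 0 <= M ->
  (forall D, evals f D ^+ 2 <= M * rip (kcomb D) (kcomb D)) ->
  hspace H f /\ hnorm2 H f <= M.
Proof.
move=> M0 hM.
pose J D := rip (kcomb D) (kcomb D) - 2 * evals f D.
(* With p^2 <= M N, assuming M + N < 2p would give (M + N)^2 < 4 M N, against (M - N)^2 >= 0. *)
have J_ge D : - M <= J D.
  have N0 := rip_ge0 (hspace_kcomb D); have := hM D.
  rewrite /J; set N := rip _ _ in N0 *; set p := evals f D => hp.
  rewrite leNgt; apply/negP => hlt.
  have h1 : M + N < 2 * p by lra.
  have h2 : (M + N) ^+ 2 < (2 * p) ^+ 2.
    by rewrite ltr_pXn2r ?nnegrE //; lra.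
  by have := sqr_ge0 (M - N); nra.
pose m := inf (range J).
have hinf : has_inf (range J).
  by split; [exists (J [::]); exists [::]|exists (- M) => _ [D _ <-]].
have m_le D : m <= J D by apply: ge_inf; [exact: hinf.2|exists D].
have [D_ hD] : exists D_ : nat -> seq (Ell R * hvec R r), forall k, J (D_ k) < m + k.+1%:R^-1.
  suff /choice[D_ hD] : forall k : nat, exists D, J D < m + k.+1%:R^-1 by exists D_.
  move=> k.
  have [|_ [D _ <-] ?] := @inf_adherent _ (range J) (k.+1%:R^-1) _ hinf.
    by rewrite invr_gt0.
  by exists D.
(* Approximate Euler equation: J (D + t E) - m is a nonnegative quadratic in t, and this is its
   discriminant bound. *)
have perturb D E :
    (rip (kcomb D) (kcomb E) - evals f E) ^+ 2 <=
      rip (kcomb E) (kcomb E) * (J D - m).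
  apply: discriminant_le0 => [|t]; first exact: rip_ge0 (hspace_kcomb _).
  have := m_le (addscale D t E).
  rewrite /J kcomb_addscale evals_addscale rip_addscale2; try exact: hspace_kcomb.
  by lra.
have cauchy k l : rip (hfsub (kcomb (D_ k)) (kcomb (D_ l)))
    (hfsub (kcomb (D_ k)) (kcomb (D_ l))) <= 2 * (k.+1%:R^-1 + l.+1%:R^-1).
  rewrite hfsubE -kcomb_addscale; set E := addscale _ _ _.
  have hk := perturb (D_ k) E; have hl := perturb (D_ l) E.
  have N0 := rip_ge0 (hspace_kcomb E).
  (* For E = D_k - D_l and p = [evals f E], |E|^2 is (a - p) - (b - p). [perturb] bounds the two
     squares by |E|^2/(k+1) and |E|^2/(l+1), and (x - y)^2 <= 2x^2 + 2y^2 concludes after division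
     by |E|^2. *)
  have NE : rip (kcomb E) (kcomb E) =
      rip (kcomb (D_ k)) (kcomb E) - rip (kcomb (D_ l)) (kcomb E).
    rewrite [X in rip X _ = _]kcomb_addscale rip_addscalel; try exact: hspace_kcomb.
    by rewrite mulN1r.
  have := hD k; have := hD l; move: hk hl N0 NE.
  set N := rip (kcomb E) _; set a := rip _ _; set b := rip _ _.
  set Jk := J _; set Jl := J _; set p := evals _ _.
  set el := _^-1; set ek := _^-1 => hk hl N0 NE hJl hJk.
  move: N0; rewrite le_eqVlt => /predU1P[<-|Ngt].
    by rewrite mulr_ge0 // addr_ge0 // invr_ge0.
  rewrite -(ler_pM2l Ngt).
  have h1 : N * (Jk - m) <= N * ek by rewrite ler_pM2l //; lra.
  have h2 : N * (Jl - m) <= N * el by rewrite ler_pM2l //; lra.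
  have h3 : N * N = ((a - p) - (b - p)) ^+ 2 by rewrite NE; ring.
  have := sqr_ge0 ((a - p) + (b - p)); lra.
have small (e : R) : 0 < e -> exists N, forall k, (N <= k)%N -> k.+1%:R^-1 < e.
  move=> e0; have ie0 : 0 <= e^-1 by rewrite invr_ge0 ltW.
  have hb := archi_boundP ie0; exists (Num.bound e^-1) => k hk.
  rewrite invf_plt ?posrE //; apply: lt_le_trans hb _.
  by rewrite ler_nat (leq_trans hk).
have [|g hg lim_g] := complete (q := H) (fun k => hspace_kcomb (D_ k)).
  move=> e e0; have [|N hN] := small (e / 4); first by rewrite divr_gt0.
  exists N => k l hk hl; apply: le_lt_trans (cauchy k l) _.
  by move: (hN _ hk) (hN _ hl); move: (k.+1%:R^-1) (l.+1%:R^-1) => a b; lra.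
have expand k : rip (hfsub (kcomb (D_ k)) g) (hfsub (kcomb (D_ k)) g) =
    rip (kcomb (D_ k)) (kcomb (D_ k)) - 2 * rip g (kcomb (D_ k)) + rip g g.
  rewrite hfsubE rip_addscale2 //; last exact: hspace_kcomb.
  by rewrite [rip g (kcomb _)]ripC //; [ring|exact: hspace_kcomb].
have g_evals E : rip g (kcomb E) = evals f E.
  have N0 := rip_ge0 (hspace_kcomb E).
  apply/eqP; rewrite -subr_eq0 -sqrf_eq0 eq_le sqr_ge0 andbT.
  apply/ler_addgt0Pr => e e0; rewrite add0r.
  have N1 : 0 < rip (kcomb E) (kcomb E) + 1 by lra.
  (* The squared defect is at most 2 |D_k - g|^2 N + 2 N (J D_k - m) <= 4 N e' with N = |E|^2; the
     added 1 keeps the divisor positive. *)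
  pose e' := e / (4 * (rip (kcomb E) (kcomb E) + 1)).
  have e'0 : 0 < e' by rewrite divr_gt0 // mulr_gt0.
  have eE : e = 4 * (rip (kcomb E) (kcomb E) + 1) * e'.
    by rewrite /e'; field; rewrite gt_eqF.
  clearbody e'; have [N1' h1] := lim_g _ e'0; have [N2 h2] := small _ e'0.
  pose k := maxn N1' N2.
  have {}h1 := h1 k (leq_maxl _ _); have {}h2 := h2 k (leq_maxr _ _).
  have hs : hspace H (hfsub (kcomb (D_ k)) g).
    by rewrite hfsubE; apply: hspace_addscale => //; exact: hspace_kcomb.
  have := rip_CS hs (hspace_kcomb E).
  rewrite {1}hfsubE rip_addscalel //; try exact: hspace_kcomb.
  have := perturb (D_ k) E; have := hD k; move: h1 h2 N0 N1 eE; rewrite -/(rip _ _).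
  set N := rip (kcomb E) _; set b := rip (kcomb _) _; set a := rip g _.
  set p := evals _ _; set s := rip _ _; set ek := _^-1 => h1 h2 N0 N1 eE hJ hp hc.
  have k1 : s * N <= e' * N by rewrite ler_wpM2r // ltW.
  have k2 : N * (J (D_ k) - m) <= N * e' by rewrite ler_wpM2l //; lra.
  have := sqr_ge0 (a + p - 2 * b); rewrite eE; lra.
have fg : f = g.
  apply/funext => y; apply: dot_inj => c.
  by have := g_evals [:: (y, c)]; rewrite rip_kcomb // /evals !big_seq1.
split; first by rewrite fg.
(* Since g represents f, |D_k - g|^2 = J D_k + |f|^2. It becomes arbitrarily small while J >= -M,
   hence |f|^2 <= M. *)
rewrite /hnorm2 -/(rip f f) {1 2}fg; apply/ler_addgt0Pr => e e0.
have [N /(_ N (leqnn _))] := lim_g _ e0.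
rewrite -/(rip _ _) expand g_evals; have := J_ge (D_ N); rewrite /J; lra.
Qed.

End KernelCombinations.

(** * Exponentially decaying coefficient sequences *)

Section Decay.
Variables (R : realType).
Local Open Scope classical_set_scope.

Lemma cvg_series_sum I (l : seq I) (F : I -> nat -> R) (L : I -> R) :
  (forall i, series (F i) @ \oo --> L i) ->
  series (fun k => \sum_(i <- l) F i k) @ \oo --> \sum_(i <- l) L i.
Proof.
move=> h; have -> : series (fun k => \sum_(i <- l) F i k) =
    (fun n => \sum_(i <- l) series (F i) n).
  by apply/funext => n; rewrite /series /= exchange_big.
exact: cvg_sumr.
Qed.

Lemma wseries_adjM r s (A : nat -> hmat R r s) L t (c : hmat R r t) :
  wseries A L -> wseries (fun k => hadj (A k) *m c) (hadj L *m c).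
Proof.
move=> wA C; rewrite dot_adjMl dotC dotMr.
by apply: eq_cvg_series (wA (c *m hadj C)) => k; rewrite dot_adjMl [RHS]dotC dotMr.
Qed.

Lemma wseries_sum r s I (l : seq I) (A : I -> nat -> hmat R r s) L :
  (forall i, wseries (A i) (L i)) ->
  wseries (fun k => \sum_(i <- l) A i k) (\sum_(i <- l) L i).
Proof.
move=> wA C; rewrite dot_suml.
have := cvg_series_sum (l := l) (fun i => wA i C); apply: eq_cvg_series => k.
by rewrite dot_suml.
Qed.

Lemma adj_scale r s t q (A : hmat R r s) (c : hmat R r t) :
  hadj (q *: A) *m c = hadj A *m (qconj q *: c).
Proof.
apply: dot_inj => C; rewrite !dot_adjMl dotZl -scalemxAl; congr (dot _ (_ *: _)).
by apply: quatP; split=> //=; rewrite opprK.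
Qed.

Variable r : nat.
Implicit Types a b : nat -> hvec R r.

Definition decays (rho A : R) a := forall n, hnorm (a n) <= A * rho ^+ n.

Definition nrg a : R := limn (series (fun n => dot (a n) (a n))).

Lemma decays_ge0 rho A a : decays rho A a -> 0 <= A.
Proof. by move=> /(_ 0); rewrite expr0 mulr1; apply: le_trans; exact: hnorm_ge0. Qed.

Lemma decays_le rho rho' A A' a : 0 <= rho -> rho <= rho' -> A <= A' ->
  decays rho A a -> decays rho' A' a.
Proof.
move=> r0 rr AA da n; apply: le_trans (da n) _.
apply: ler_pM; rewrite ?exprn_ge0 ?(decays_ge0 da) //.
by rewrite lerXn2r ?nnegrE // (le_trans r0).
Qed.

Lemma decaysD rho A B a b : decays rho A a -> decays rho B b ->
  decays rho (A + B) (fun n => a n + b n).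
Proof.
by move=> da db n; rewrite mulrDl; apply: le_trans (hnormD _ _) _; rewrite lerD.
Qed.

Lemma decaysZ rho A (t : R) a : decays rho A a ->
  decays rho (`|t| * A) (fun n => qreal t *: a n).
Proof. by move=> da n; rewrite hnormZ qnorm_real -mulrA ler_wpM2l. Qed.

Lemma sqr_lt1 (rho : R) : 0 <= rho < 1 -> 0 <= rho ^+ 2 < 1.
Proof. by move=> /andP[r0 r1]; rewrite exprn_ge0 // expr_lt1. Qed.

Lemma cvg_nrg rho A a : 0 <= rho < 1 -> decays rho A a ->
  series (fun n => dot (a n) (a n)) @ \oo --> nrg a.
Proof.
move=> rho01 da.
have [|k|l hl _] := @cvg_series_geometric_le R (fun n => dot (a n) (a n)) (A ^+ 2) (rho ^+ 2).
- exact: sqr_lt1.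
- by rewrite -sqr_hnorm normrX ger0_norm ?hnorm_ge0 // exprAC -exprMn lerXn2r ?nnegrE
    ?hnorm_ge0 ?(le_trans _ (da k)) ?hnorm_ge0.
- exact/cvgP/hl.
Qed.

(** Termwise |a|^2 - |b|^2 = <a - b, a> + <a - b, b>, where b decays with constant A + eta. *)
Lemma nrg_close rho A eta a b : 0 <= rho < 1 -> decays rho A a ->
  decays rho eta (fun n => a n - b n) ->
  `|nrg a - nrg b| <= eta * (2 * A + eta) / (1 - rho ^+ 2).
Proof.
move=> rho01 da dab.
have db : decays rho (A + eta) b.
  move=> n; rewrite (_ : b n = a n - (a n - b n)); last by rewrite opprB addrC subrK.
  by rewrite mulrDl; apply: le_trans (hnormD _ _) _; rewrite hnormN lerD.
have ca := cvg_nrg rho01 da; have cb := cvg_nrg rho01 db.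
have [||l hl bl] := @cvg_series_geometric_le R
  (fun n => dot (a n) (a n) - dot (b n) (b n)) (eta * (2 * A + eta)) (rho ^+ 2).
- exact: sqr_lt1.
- move=> n; have -> : dot (a n) (a n) - dot (b n) (b n) =
    dot (a n - b n) (a n) + dot (a n - b n) (b n).
    by rewrite !dotBl [dot (b n) (a n)]dotC addrA subrK.
  apply: le_trans (ler_normD _ _) _.
  have -> : eta * (2 * A + eta) * (rho ^+ 2) ^+ n =
    (eta * rho ^+ n) * (A * rho ^+ n) + (eta * rho ^+ n) * ((A + eta) * rho ^+ n).
    by rewrite exprAC; ring.
  by apply: lerD; apply: le_trans (dot_le _ _) _; apply: ler_pM; rewrite ?hnorm_ge0.
suff -> : nrg a - nrg b = l by [].
apply: cvg_unique hl => //.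
rewrite (_ : series _ = series (fun n => dot (a n) (a n)) \- series (fun n => dot (b n) (b n))).
  exact: cvgB.
by apply/funext => n; rewrite /= /series /= -sumrB.
Qed.

Definition acomb (D : seq (Ell R * hvec R r)) n : hvec R r :=
  \sum_(p <- D) qconj (Ppoly n (val p.1)) *: p.2.

Lemma acomb_addscale D t E n :
  acomb (addscale D t E) n = acomb D n + qreal t *: acomb E n.
Proof.
rewrite /acomb big_cat big_map scaler_sumr; congr (_ + _).
by apply: eq_bigr => p _; rewrite !scalerA qreal_comm.
Qed.

Lemma acomb_decays D :
  exists rho A, [/\ 0 < rho, rho < 1 & decays rho A (acomb D)].
Proof.
elim: D => [|[y c] D [rho [A [r0 r1 dA]]]].
  exists (1 / 2), 0; split; [lra|lra|] => n.
  by rewrite /acomb big_nil hnorm0 mul0r.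
have [rho' [C [r0' r1' C0 hC]]] := qnorm_Ppoly_geometric y.
have mx0 : 0 < Num.max rho rho' by rewrite lt_max r0.
exists (Num.max rho rho'), (C * hnorm c + A); split=> //; first by rewrite gt_max r1.
move=> n; rewrite /acomb big_cons.
apply: (@decaysD (Num.max rho rho') _ _ (fun n => qconj (Ppoly n (val y)) *: c) (acomb D)).
  move=> k; rewrite hnormZ qnorm_conj mulrAC ler_wpM2r ?hnorm_ge0 //.
  apply: le_trans (hC k) _; rewrite ler_wpM2l // lerXn2r ?nnegrE ?(ltW r0') ?(ltW mx0) //.
  by rewrite le_max lexx orbT.
by apply: (decays_le (ltW r0) _ (lexx A) dA); rewrite le_max lexx.
Qed.

(** * Density of the coefficient sequences of kernel combinations *)

Section Density.
Variable rho : R.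
Hypotheses (rho0 : 0 < rho) (rho1 : rho < 1).

(** Closure in the weighted sup norm of |a_n| rho^(-n), for which both the energy and the Toeplitz
    operator are continuous. *)
Definition approximable a := forall eta : R, 0 < eta ->
  exists D, decays rho eta (fun n => a n - acomb D n).

Lemma approximable_acomb D : approximable (acomb D).
Proof.
move=> eta e0; exists D => n.
by rewrite subrr hnorm0 mulr_ge0 ?exprn_ge0 // ltW.
Qed.

Lemma approximable_addscale t a b : approximable a -> approximable b ->
  approximable (fun n => a n + qreal t *: b n).
Proof.
move=> ha hb eta e0.
have t1 : 0 < `|t| + 1 by rewrite ltr_wpDl.
have [|D hD] := ha (eta / 2); first by rewrite divr_gt0.
have [|E hE] := hb (eta / 2 / (`|t| + 1)); first by rewrite !divr_gt0.
exists (addscale D t E).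
apply: (@decays_le rho rho (eta / 2 + `|t| * (eta / 2 / (`|t| + 1)))).
- exact: ltW.
- exact: lexx.
- rewrite [leRHS](splitr eta) lerD2l mulrCA ler_piMr ?divr_ge0 ?(ltW e0) //.
  by rewrite ler_pdivrMr // mul1r lerDl.
move=> n; have := decaysD hD (decaysZ t hE) n; rewrite acomb_addscale scalerBr.
by rewrite addrACA -opprD.
Qed.

Lemma approximable_closed a :
  (forall eta : R, 0 < eta ->
    exists2 b, approximable b & decays rho eta (fun n => a n - b n)) ->
  approximable a.
Proof.
move=> h eta e0; have e2 : 0 < eta / 2 by rewrite divr_gt0.
have [b hb dab] := h _ e2; have [D hD] := hb _ e2; exists D => n.
have := decaysD dab hD n; rewrite -splitr.
by rewrite addrA subrK.
Qed.

Lemma approximable_sum k (F : nat -> nat -> hvec R r) :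
  (forall j, (j < k)%N -> approximable (F j)) ->
  approximable (fun n => \sum_(j < k) F j n).
Proof.
elim: k => [|k IH] hF.
  under eq_fun do rewrite big_ord0.
  have := approximable_acomb [::]; congr approximable; apply/funext => n.
  by rewrite /acomb big_nil.
under eq_fun do rewrite big_ord_recr /=.
have := approximable_addscale 1 (IH (fun j hj => hF j (ltnW hj))) (hF k (ltnSn k)).
congr approximable; apply/funext => n.
by rewrite [qreal 1]/(1 : quat R) scale1r.
Qed.

Definition dirac_seq (k : nat) (w : hvec R r) n : hvec R r := if n == k then w else 0.

Lemma sum_dirac_seq N (v : nat -> hvec R r) n :
  \sum_(j < N) dirac_seq j (v j) n = if (n < N)%N then v n else 0.
Proof.
rewrite /dirac_seq -big_mkcond /=; case: ltnP => nN.
  by rewrite (big_pred1 (Ordinal nN)) // => j; rewrite eq_sym -val_eqE.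
by rewrite big1 // => j /eqP nj; have := ltn_ord j; rewrite -nj ltnNge nN.
Qed.

(* Along imaginary points, t^(-k) (acomb - lower order terms) tends to the Dirac
   sequence at k as t tends to 0. *)
Lemma approximable_dirac k w : approximable (dirac_seq k w).
Proof.
elim/ltn_ind: k w => k IH w; apply: approximable_closed => eta e0.
(* The kernel at t i with vector i^k w has coefficients t^n v_n; the factor i^k is there to make v_k
   = w. *)
pose v n := qconj (qimag 1 ^+ n) *: (qimag 1 ^+ k *: w) : hvec R r.
have vk : v k = w.
  rewrite /v scalerA (_ : _ * _ = 1) ?scale1r //.
  by rewrite qconj_mulV -sqr_qnorm qnorm_qimag1X expr1n.
have hv n : hnorm (v n) = hnorm w.
  by rewrite /v !hnormZ qnorm_conj !qnorm_qimag1X !mul1r.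
have er0 : 0 < eta * rho ^+ k by rewrite mulr_gt0 ?exprn_gt0.
have dn0 : 0 < eta * rho ^+ k + hnorm w by rewrite ltr_pwDl ?hnorm_ge0.
(* With t = rho tau, the error at n > k is t^(n-k) |w| <= rho^(n-k) tau |w|, and tau |w| <= eta
   rho^k turns this into eta rho^n. *)
pose tau := eta * rho ^+ k / (eta * rho ^+ k + hnorm w).
have tau0 : 0 < tau by rewrite divr_gt0.
have tau1 : tau <= 1 by rewrite ler_pdivrMr // mul1r lerDl hnorm_ge0.
have tauw : tau * hnorm w <= eta * rho ^+ k.
  by rewrite mulrAC ler_pdivrMr // ler_wpM2l ?(ltW er0) // lerDr ltW.
pose t := rho * tau; have t0 : 0 < t by rewrite mulr_gt0.
have t1 : t < 1 by apply: le_lt_trans rho1; rewrite ler_piMr // ltW.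
have tE : inEll (qimag t) by apply: inEll_qimag; rewrite gtr0_norm.
pose D := [:: (exist (fun x => inEll x) _ tE : Ell R, qimag 1 ^+ k *: w)].
have aD n : acomb D n = qreal (t ^+ n) *: v n.
  by rewrite /acomb big_seq1 /= Ppoly_qimag qconj_realM /v -[in LHS]scalerA.
pose low n := \sum_(j < k) dirac_seq j (qreal (t ^+ j) *: v j) n.
have hlow : approximable low.
  exact: (@approximable_sum k (fun j => dirac_seq j (qreal (t ^+ j) *: v j))
    (fun j hj => IH j hj _)).
pose b n := acomb D n + qreal (- 1) *: low n.
have hb : approximable b.
  by apply: approximable_addscale => //; exact: approximable_acomb.
(* The leading 0 is [acomb [::]], so that [approximable_addscale] also covers plain scaling. *)
exists (fun n => 0 + qreal (t ^- k) *: b n).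
  have := approximable_addscale (t ^- k) (approximable_acomb [::]) hb.
  congr approximable; apply/funext => n.
  by rewrite /acomb big_nil.
have bE n : b n = if (n < k)%N then 0 else qreal (t ^+ n) *: v n.
  rewrite /b aD /low (sum_dirac_seq k (fun j => qreal (t ^+ j) *: v j)).
  have -> : qreal (-1) = - 1 :> quat R by apply: quatP; split=> /=; rewrite ?oppr0.
  by case: ifP => _; rewrite scaleN1r ?subrr ?subr0.
move=> n; rewrite add0r bE /dirac_seq.
have tk0 : t ^+ k != 0 by rewrite expf_neq0 // gt_eqF.
case: ltngtP => [nk|kn|->].
- by rewrite scaler0 subrr hnorm0 mulr_ge0 ?exprn_ge0 // ltW.
- rewrite sub0r hnormN scalerA -qrealM hnormZ qnorm_real hv.
  have -> : t ^- k * t ^+ n = t ^+ (n - k).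
    by rewrite -[in LHS](subnK (ltnW kn)) exprD mulrCA mulVf // mulr1.
  rewrite ger0_norm ?exprn_ge0 ?(ltW t0) // /t exprMn -mulrA.
  have -> : eta * rho ^+ n = rho ^+ (n - k) * (eta * rho ^+ k).
    by rewrite mulrCA -exprD subnK // ltnW.
  rewrite ler_wpM2l ?exprn_ge0 ?(ltW rho0) //; apply: le_trans tauw.
  rewrite ler_wpM2r ?hnorm_ge0 // -[leRHS]expr1.
  by apply: ler_wiXn2l => //; [exact: ltW | rewrite subn_gt0].
- rewrite scalerA -qrealM mulVf // [qreal 1]/(1 : quat R) scale1r vk subrr hnorm0.
  by rewrite mulr_ge0 ?exprn_ge0 // ltW.
Qed.

(** Truncations are finite sums of Dirac sequences. The strict gap rho' < rho makes the tail small
    relative to rho^n. *)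
Lemma approximable_decays rho' A a : 0 <= rho' -> rho' < rho ->
  decays rho' A a -> approximable a.
Proof.
move=> r0' rr da; apply: approximable_closed => eta e0.
have q0 : 0 <= rho' / rho by rewrite divr_ge0 // ltW.
have q1 : `|rho' / rho| < 1 by rewrite ger0_norm // ltr_pdivrMr // mul1r.
have A0 := decays_ge0 da.
have [N hN] : exists N, A * (rho' / rho) ^+ N <= eta.
  have /cvgrPdist_lt/(_ _ e0)[N _ hN] := @cvg_geometric R A _ q1.
  exists N; have := hN N (leqnn _); rewrite /= sub0r normrN => /ltW.
  by apply: le_trans; exact: ler_norm.
exists (fun n => \sum_(j < N) dirac_seq j (a j) n).
  exact: (@approximable_sum N (fun j => dirac_seq j (a j)) (fun j _ => approximable_dirac _ _)).
move=> n; rewrite sum_dirac_seq; case: ltnP => nN.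
  by rewrite subrr hnorm0 mulr_ge0 ?exprn_ge0 // ltW.
rewrite subr0; apply: le_trans (da n) _.
have -> : A * rho' ^+ n = A * (rho' / rho) ^+ n * rho ^+ n.
  by rewrite expr_div_n -mulrA divfK // expf_neq0 // gt_eqF.
rewrite ler_wpM2r ?exprn_ge0 ?(ltW rho0) //; apply: le_trans hN.
rewrite ler_wpM2l // ler_wiXn2l //; by rewrite -[leLHS]ger0_norm // ltW.
Qed.

End Density.
End Decay.

(** * The co-analytic Toeplitz operator *)

Section Toeplitz.
Variables (R : realType) (r s : nat) (S : nat -> hmat R r s).
Local Open Scope classical_set_scope.

Definition toeplitz (a : nat -> hvec R r) (n : nat) : hvec R s :=
  hser (fun m => hadj (S m) *m a (n + m)%N).

Hypothesis S_growth : forall sigma : R, 0 < sigma < 1 ->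
  exists2 C, 0 <= C & forall m, hnorm (S m) * sigma ^+ m <= C.

(** For sigma between rho and 1, the m-th term is at most C A rho^n (rho/sigma)^m. The constant N
    does not depend on a, so small errors in a stay small. *)
Lemma toeplitz_decays (rho : R) : 0 < rho < 1 -> exists2 N : R, 0 <= N &
  forall a A, decays rho A a ->
    (forall n, wseries (fun m => hadj (S m) *m a (n + m)%N) (toeplitz a n)) /\
    decays rho (N * A) (toeplitz a).
Proof.
move=> /andP[r0 r1].
pose sigma := (1 + rho) / 2.
have s0 : 0 < sigma by rewrite divr_gt0 // addr_gt0.
have s1 : sigma < 1 by rewrite ltr_pdivrMr //; lra.
have rs : rho < sigma by rewrite ltr_pdivlMr //; lra.
clearbody sigma; have [|C C0 hC] := S_growth (sigma := sigma); first by rewrite s0.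
have q01 : 0 <= rho / sigma < 1.
  by rewrite divr_ge0 ?ltW //= ltr_pdivrMr // mul1r.
have /andP[q0 q1] := q01.
exists (C / (1 - rho / sigma)) => [|a A da].
  by rewrite divr_ge0 // subr_ge0 ltW.
suff h n : wseries (fun m => hadj (S m) *m a (n + m)%N) (toeplitz a n) /\
    hnorm (toeplitz a n) <= C * (A * rho ^+ n) / (1 - rho / sigma).
  split=> [n|n]; first by have [] := h n.
  by have [_] := h n; rewrite -!mulrA ![_^-1 * _]mulrC !mulrA.
apply: wseries_geometric => // m.
apply: le_trans (hnormM _ _) _; rewrite hnorm_adj.
apply: le_trans (ler_wpM2l (hnorm_ge0 _) (da (n + m)%N)) _.
have -> : hnorm (S m) * (A * rho ^+ (n + m)) =
    (hnorm (S m) * sigma ^+ m) * (A * rho ^+ n * (rho / sigma) ^+ m).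
  have -> : rho ^+ (n + m) = rho ^+ n * (sigma ^+ m * (rho / sigma) ^+ m).
    by rewrite exprD expr_div_n; congr (_ * _); rewrite mulrC divfK // expf_neq0 // gt_eqF.
  by ring.
rewrite -[leRHS]mulrA ler_wpM2r ?hC // mulr_ge0 ?exprn_ge0 //.
by rewrite mulr_ge0 ?(decays_ge0 da) // exprn_ge0 // ltW.
Qed.

Lemma toeplitzB (rho : R) a b A B : 0 < rho < 1 -> decays rho A a -> decays rho B b ->
  forall n, toeplitz (fun k => a k - b k) n = toeplitz a n - toeplitz b n.
Proof.
move=> r01 da db n; have [N _ hN] := toeplitz_decays r01.
have [wa _] := hN _ _ da; have [wb _] := hN _ _ db.
have w := wseriesD (wa n) (wseriesN (wb n)).
rewrite -(wseries_hser w).2 /toeplitz; congr hser; apply/funext => m.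
by rewrite mulmxBr.
Qed.

Variable HK : qRKHS (KS S).
Hypothesis S_CKP : forall (n : nat) (x : Ell R), CKP_cvg n S (val x).
Hypothesis S_KS : forall x y : Ell R, hser_cvg (KSterm S (val x) (val y)).

(** Conjugating P_(n+m) S_m moves the scalar onto the vector. This identifies the subtracted part of
    [KSterm] as a Gram form of Toeplitz images. *)
Lemma toeplitz_acomb D n :
  toeplitz (acomb D) n = \sum_(p <- D) hadj (CKP n S (val p.1)) *m p.2.
Proof.
have w := wseries_sum (l := D)
  (fun p => wseries_adjM (c := p.2) (hser_wseries (@S_CKP n p.1))).
rewrite -(wseries_hser w).2 /toeplitz; congr hser; apply/funext => m.
rewrite /acomb mulmx_sumr; apply: eq_bigr => p _.
by rewrite hscalE adj_scale.
Qed.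

Lemma rip_kcomb_energy D :
  series (fun n => dot (acomb D n) (acomb D n)
                   - dot (toeplitz (acomb D) n) (toeplitz (acomb D) n)) @ \oo -->
  rip HK (kcomb (KS S) D) (kcomb (KS S) D).
Proof.
rewrite rip_kcomb; last exact: hspace_kcomb.
rewrite /evals /kcomb.
have -> : \sum_(p <- D) dot (\sum_(q <- D) KS S (val p.1) (val q.1) *m q.2) p.2 =
  \sum_(p <- D) \sum_(q <- D) dot (KS S (val p.1) (val q.1)) (p.2 *m hadj q.2).
  by apply: eq_bigr => p _; rewrite dot_suml; apply: eq_bigr => q _; rewrite dotMr.
apply: (@eq_cvg_series _ (fun n => \sum_(p <- D) \sum_(q <- D)
   dot (KSterm S (val p.1) (val q.1) n) (p.2 *m hadj q.2))) => [n|]; last first.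
  by apply: cvg_series_sum => p; apply: cvg_series_sum => q; exact: hser_wseries.
rewrite toeplitz_acomb /acomb ![dot (\sum_(p <- D) _) _]dot_suml -sumrB.
apply: eq_bigr => p _; rewrite ![dot _ (\sum_(q <- D) _)]dotC !dot_suml -sumrB.
apply: eq_bigr => q _; rewrite -dotMr.
rewrite /KSterm hsubE hscalE honeE !hmulE mulmxBl dotBl -scalemxAl mul1mx -mulmxA.
congr (_ - _).
  by rewrite -[qmul _ _]/(Ppoly n (val p.1) * qconj (Ppoly n (val q.1))) -scalerA [LHS]dotZl.
exact: dotMl.
Qed.

(** Exponential decay of both sequences allows the single series of differences to be split. *)
Lemma rip_kcomb_nrg D :
  rip HK (kcomb (KS S) D) (kcomb (KS S) D) = nrg (acomb D) - nrg (toeplitz (acomb D)).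
Proof.
have [rho [A [r0 r1 dA]]] := acomb_decays D.
have r01 : 0 < rho < 1 by rewrite r0.
have r01' : 0 <= rho < 1 by rewrite ltW.
have [N _ /(_ _ _ dA)[_ dT]] := toeplitz_decays r01.
apply: cvg_unique (rip_kcomb_energy (D := D)) _ => //.
rewrite (_ : series _ = series (fun n => dot (acomb D n) (acomb D n)) \-
  series (fun n => dot (toeplitz (acomb D) n) (toeplitz (acomb D) n))).
  by apply: cvgB; [exact: cvg_nrg dA | exact: cvg_nrg dT].
by apply/funext => n; rewrite /= /series /= -sumrB.
Qed.

(* The energy identity gives contractivity on the sequences acomb D, and these are dense. *)
Lemma toeplitz_contraction (rho : R) a A : 0 < rho < 1 -> decays rho A a ->
  nrg (toeplitz a) <= nrg a.
Proof.
move=> /andP[r0 r1] da.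
(* Density holds only at a rate strictly slower than the decay of a, so some room below 1 is given
   up. *)
pose rho' := (1 + rho) / 2.
have p1 : rho' < 1 by rewrite ltr_pdivrMr //; lra.
have rp : rho < rho' by rewrite ltr_pdivlMr //; lra.
have p0 : 0 < rho' by exact: lt_trans rp.
have p01 : 0 < rho' < 1 by rewrite p0.
have p01' : 0 <= rho' < 1 by rewrite ltW.
have A0 := decays_ge0 da.
have da' : decays rho' A a by apply: (decays_le (ltW r0) (ltW rp) (lexx A) da).
have [N N0 hN] := toeplitz_decays p01.
have d0 : 0 < (1 - rho' ^+ 2)^-1.
  by have /andP[_] := sqr_lt1 p01'; rewrite invr_gt0 subr_gt0.
set d := _^-1 in d0.
(* The two energy errors, for a and for its image, add up to at most eta C once eta <= 1; eta = e/(e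
   + C) gives both eta <= 1 and eta C <= e. *)
pose C := (1 + N ^+ 2) * (2 * A + 1) * d.
have C0 : 0 <= C by rewrite !mulr_ge0 ?addr_ge0 ?mulr_ge0 ?exprn_ge0 // ltW.
apply/ler_addgt0Pr => e e0.
have eC0 : 0 < e + C by rewrite ltr_pwDl.
pose eta := e / (e + C).
have eta0 : 0 < eta by rewrite divr_gt0.
have eta1 : eta <= 1 by rewrite ler_pdivrMr // mul1r lerDl.
have etaC : eta * C <= e by rewrite mulrAC ler_pdivrMr // ler_wpM2l ?(ltW e0) // lerDr ltW.
have [D hD] := approximable_decays p0 p1 (ltW r0) rp da eta0.
have [rho2 [B [b0 b1 dB]]] := acomb_decays D.
have dD : decays rho' (A + eta) (acomb D).
  move=> n; rewrite (_ : acomb D n = a n - (a n - acomb D n)).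
    by rewrite mulrDl; apply: le_trans (hnormD _ _) _; rewrite hnormN lerD.
  by rewrite opprB addrC subrK.
have close1 := nrg_close p01' da' hD.
have [_ dTa] := hN _ _ da'; have [_] := hN _ _ hD.
have -> : toeplitz (fun n => a n - acomb D n) =
    fun n => toeplitz a n - toeplitz (acomb D) n.
  by apply/funext => n; rewrite (toeplitzB p01 da' dD).
move=> dTD; have close2 := nrg_close p01' dTa dTD.
have contr : nrg (toeplitz (acomb D)) <= nrg (acomb D).
  by rewrite -subr_ge0 -rip_kcomb_nrg; apply: rip_ge0; exact: hspace_kcomb.
rewrite -/d in close1 close2.
move: (ler_norm (nrg (toeplitz a) - nrg (toeplitz (acomb D)))) => l2.
move: close1; rewrite ler_norml => /andP[l1 _].
have bound : eta * (2 * A + eta) * d + N * eta * (2 * (N * A) + N * eta) * d <= eta * C.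
  have -> : eta * (2 * A + eta) * d + N * eta * (2 * (N * A) + N * eta) * d =
    eta * ((1 + N ^+ 2) * (2 * A + eta) * d) by ring.
  rewrite ler_wpM2l ?(ltW eta0) // ler_wpM2r ?(ltW d0) // ler_wpM2l ?lerD2l //.
  by rewrite addr_ge0 ?sqr_ge0.
by move: (etaC) (bound) (l1) (l2) (close2) (contr); lra.
Qed.

End Toeplitz.

(** * The backward shift of a Schur multiplier *)

Section SchurMultiplier.
Variables (R : realType) (r s : nat) (S : nat -> hmat R r s).
Local Open Scope classical_set_scope.
Hypothesis S_CKP : forall (n : nat) (x : Ell R), CKP_cvg n S (val x).

(** At the point sigma i the m-th term of the series of S has norm |S_m| sigma^m, and terms of a
    convergent series are bounded. The domain contains these points for every sigma < 1. *)
Lemma CKP_growth (sigma : R) : 0 < sigma < 1 ->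
  exists2 C, 0 <= C & forall m, hnorm (S m) * sigma ^+ m <= C.
Proof.
move=> /andP[s0 s1].
have sE : inEll (qimag sigma) by apply: inEll_qimag; rewrite gtr0_norm.
have [C C0 hC] := wseries_bounded (S_CKP 0 (exist (fun x => inEll x) _ sE)).
exists C => // m; have := hC m.
rewrite hscalE hnormZ /= add0n Ppoly_qimag qnormM qnorm_real qnorm_qimag1X mulr1.
by rewrite ger0_norm ?exprn_ge0 ?(ltW s0) // mulrC.
Qed.

Lemma hfun_at0 : hfun S (qzero R) = S 0.
Proof.
have E n : Ppoly n (qzero R) = qreal (0 ^+ n) * qimag 1 ^+ n by exact: Ppoly_qimag.
have w : wseries (fun n => hscal (Ppoly n (qzero R)) (S n))
    (hscal (Ppoly 0 (qzero R)) (S 0) + 0).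
  apply: wseriesS; apply: wseries0 => n.
  by rewrite hscalE E exprS mul0r [qreal 0]/(0 : quat R) mul0r scale0r.
rewrite /hfun (wseries_hser w).2 hscalE E expr0 [qreal 1]/(1 : quat R).
by rewrite expr0 mulr1 scale1r addr0.
Qed.

Variable u : hvec R s.
Let f (y : Ell R) := hfun (R0coef (fun n => hmul (S n) u)) (val y).

Lemma R0_wseries (y : Ell R) :
  wseries (fun n => hscal (Ppoly n (val y)) (hmul (S n.+1) u)) (f y).
Proof.
have [rho [C [r0 r1 C0 hC]]] := qnorm_Ppoly_geometric y.
pose sigma := (1 + rho) / 2.
have s0 : 0 < sigma by rewrite divr_gt0 // addr_gt0.
have s1 : sigma < 1 by rewrite ltr_pdivrMr //; lra.
have rs : rho < sigma by rewrite ltr_pdivlMr //; lra.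
clearbody sigma; have [|B B0 hB] := @CKP_growth sigma; first by rewrite s0.
have q01 : 0 <= rho / sigma < 1.
  by rewrite divr_ge0 ?ltW //= ltr_pdivrMr // mul1r.
have /andP[q0 _] := q01.
apply: (@wseries_geometric _ _ _ _ (C * (B / sigma) * hnorm u) (rho / sigma) q01 _).1.
move=> n; rewrite hscalE hmulE hnormZ.
apply: le_trans (ler_wpM2l (qnorm_ge0 _) (hnormM _ _)) _.
(* The growth bound at index n + 1: the shift costs a factor 1/sigma. *)
have hS : hnorm (S n.+1) <= B / sigma / sigma ^+ n.
  by rewrite -mulrA -invfM -exprS ler_pdivlMr ?exprn_gt0.
have -> : C * (B / sigma) * hnorm u * (rho / sigma) ^+ n =
    (C * rho ^+ n) * (B / sigma / sigma ^+ n * hnorm u).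
  by rewrite expr_div_n; ring.
by apply: ler_pM; rewrite ?qnorm_ge0 ?mulr_ge0 ?hnorm_ge0 // ler_wpM2r ?hnorm_ge0.
Qed.

Definition prepend (v : hvec R r) (a : nat -> hvec R r) (n : nat) :=
  if n is m.+1 then a m else v.

Lemma decays_prepend (rho A : R) v a : 0 < rho -> decays rho A a ->
  decays rho (hnorm v + A / rho) (prepend v a).
Proof.
move=> r0 da [|n] /=.
  by rewrite expr0 mulr1 lerDl divr_ge0 ?(decays_ge0 da) // ltW.
apply: le_trans (da n) _; rewrite exprS mulrDl [A / rho * _]mulrA divfK ?gt_eqF // lerDr.
by rewrite !mulr_ge0 ?hnorm_ge0 ?exprn_ge0 // ltW.
Qed.

(** The right side is <L a, u>: entry 0 of the Toeplitz image minus its m = 0 term. The vector v is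
    arbitrary here and is chosen only in the quadratic estimate. *)
Lemma evals_R0 v D :
  evals f D = dot (toeplitz S (prepend v (acomb D)) 0) u - dot v (S 0 *m u).
Proof.
have [rho [A [r0 r1 dA]]] := acomb_decays D.
have r01 : 0 < rho < 1 by rewrite r0.
have [N _ hN] := toeplitz_decays CKP_growth r01.
have [/(_ 0) w _] := hN _ _ (decays_prepend v r0 dA).
have := wseries_behead w (C := u); rewrite dotBl dot_adjMl /= => w'.
apply: cvg_unique w' => //.
apply: (@eq_cvg_series _ (fun n => \sum_(p <- D)
    dot (hscal (Ppoly n (val p.1)) (hmul (S n.+1) u)) p.2)) => [n|].
  rewrite mulmx_sumr dot_suml; apply: eq_bigr => p _.
  by rewrite dot_adjMl hscalE hmulE dotZl dotC.
by apply: cvg_series_sum => p; exact: R0_wseries.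
Qed.

Variable HK : qRKHS (KS S).
Hypothesis S_KS : forall x y : Ell R, hser_cvg (KSterm S (val x) (val y)).

(** Contractivity with index 0 peeled off both energies; beyond it the image is the Toeplitz image
    of [acomb D], whose energy moves to the right to form |h|^2. *)
Lemma toeplitz_prepend_le v D :
  dot (toeplitz S (prepend v (acomb D)) 0) (toeplitz S (prepend v (acomb D)) 0) <=
    dot v v + rip HK (kcomb (KS S) D) (kcomb (KS S) D).
Proof.
have [rho [A [r0 r1 dA]]] := acomb_decays D.
have r01 : 0 < rho < 1 by rewrite r0.
have r01' : 0 <= rho < 1 by rewrite ltW.
have dp := decays_prepend v r0 dA.
have [N _ hN] := toeplitz_decays CKP_growth r01.
have [_ dT] := hN _ _ dA.
have := toeplitz_contraction CKP_growth HK S_CKP S_KS r01 dp.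
have -> : nrg (prepend v (acomb D)) = dot v v + nrg (acomb D).
  by apply: cvg_lim => //; apply: cvg_seriesS; exact: cvg_nrg dA.
have -> : nrg (toeplitz S (prepend v (acomb D))) =
   dot (toeplitz S (prepend v (acomb D)) 0) (toeplitz S (prepend v (acomb D)) 0)
   + nrg (toeplitz S (acomb D)).
  by apply: cvg_lim => //; apply: cvg_seriesS; exact: cvg_nrg dT.
rewrite (rip_kcomb_nrg CKP_growth HK S_CKP S_KS); lra.
Qed.

Let U := dot u u.
Let g := dot (S 0 *m u) (S 0 *m u).

Lemma R0_quadratic D t :
  (evals f D + t * g) ^+ 2 <=
    U * (t ^+ 2 * g + rip HK (kcomb (KS S) D) (kcomb (KS S) D)).
Proof.
pose v := qreal t *: (S 0 *m u).
have -> : evals f D + t * g = dot (toeplitz S (prepend v (acomb D)) 0) u.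
  by rewrite (evals_R0 v) /v dotRl subrK.
rewrite mulrC; apply: le_trans (dot_CS _ _) _; rewrite ler_wpM2r ?dot_ge0 //.
apply: le_trans (toeplitz_prepend_le v D) _.
by rewrite /v dotRl dotRr mulrA -expr2.
Qed.

(** The empty combination with t = 1 gives g^2 <= U g. *)
Lemma R0_defect_ge0 : 0 <= U - g.
Proof.
have U0 : 0 <= U by exact: dot_ge0.
have := R0_quadratic [::] 1.
have -> : evals f [::] = 0 by rewrite /evals big_nil.
rewrite rip_kcomb; last exact: hspace_kcomb.
rewrite /evals big_nil add0r mul1r expr1n mul1r addr0 subr_ge0 => h.
have : 0 <= g by exact: dot_ge0.
rewrite le_eqVlt => /predU1P[<- //|g0].
by rewrite -(ler_pM2r g0) -expr2.
Qed.

Lemma R0_evals_le D :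
  evals f D ^+ 2 <= (U - g) * rip HK (kcomb (KS S) D) (kcomb (KS S) D).
Proof.
have := R0_quadratic D; set X := evals f D; set Q := rip _ _ _ => hq.
have U0 : 0 <= U by exact: dot_ge0.
have g0 : 0 <= g by exact: dot_ge0.
have Ug0 := R0_defect_ge0.
(* [R0_quadratic] reads g (U - g) t^2 - 2 g X t + (U Q - X^2) >= 0. In the discriminant bound the
   X^2 terms combine through g^2 + g (U - g) = g U, leaving g U X^2 <= g U (U - g) Q. *)
have h : (- g * X) ^+ 2 <= g * (U - g) * (U * Q - X ^+ 2).
  apply: discriminant_le0 => [|t]; first exact: mulr_ge0.
  by have := hq t; lra.
(* For g = 0 the case t = 0 is already the claim; otherwise U >= g > 0 allows division by g U. *)
move: g0; rewrite le_eqVlt => /predU1P[gE|g0].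
  by have := hq 0; rewrite -gE subr0 mul0r addr0 expr0n /= mul0r add0r.
have Ug : 0 < U by lra.
rewrite -(ler_pM2l (mulr_gt0 g0 Ug)); lra.
Qed.

End SchurMultiplier.

Theorem mainTheorem17 (R : realType) (r s : nat) (S : nat -> hmat R r s)
  (HS : SchurMult S) (HK : qRKHS (KS S)) (u : hvec R s) :
  let Su := fun n => hmul (S n) u in
  let f := fun x : Ell R => hfun (R0coef Su) (val x) in
  let S0u := hmul (hfun S (qzero R)) u in
  [/\ hfun_cvg (R0coef Su),
      hspace HK f &
      hnorm2 HK f <= q0 ((hmul (hadj u) u) ord0 ord0)
                     - q0 ((hmul (hadj S0u) S0u) ord0 ord0)].
Proof.
case: HS => S_CKP S_KS _ Su f S0u.
have [||hf nf] := @rkhs_bounded_evals _ _ _ HK f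
  (dot u u - dot (S 0 *m u) (S 0 *m u)).
- exact: R0_defect_ge0.
- exact: R0_evals_le.
split=> //; first by move=> x; exact: (wseries_hser (R0_wseries S_CKP (u := u) (y := x))).1.
by rewrite /S0u hfun_at0 !hmulE !q0_adjM.
Qed.
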